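(* Abstract point-line configurations of $26$ triple points and $13$ lines are not realizable with pseudolines. That is, no abstract point-line configuration consisting of $13$ lines and $26$ points, each point incident with precisely $3$ of the lines, has a topological realization in $\mathbb{P}^2_{\mathbb{R}}$.
   Context: A pseudoline in the real projective plane $\mathbb{P}^2_{\mathbb{R}}$ is a simple closed curve whose removal does not cut $\mathbb{P}^2_{\mathbb{R}}$ into two connected components. A pseudoline arrangement is a finite set of pseudolines such that every two of them have precisely one point in common, at which they cross. An abstract point-line configuration is a finite set of (abstract) points and a finite set of (abstract) lines with an incidence relation between them, such that two distinct lines are incident with at most one common point. A triple point is a point incident with precisely $3$ lines. A topological realization (realization with pseudolines) assigns to the abstract lines distinct pseudolines forming a pseudoline arrangement in $\mathbb{P}^2_{\mathbb{R}}$, and to the abstract points distinct points of $\mathbb{P}^2_{\mathbb{R}}$, such that an abstract point is incident with an abstract line if and only if the corresponding point lies on the corresponding pseudoline. *)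

(* Defs.v *)
From HB Require Import structures.
From mathcomp Require Import all_boot all_order all_algebra.
From mathcomp Require Import generic_quotient.
From mathcomp Require Import all_classical all_reals all_analysis.

Set Implicit Arguments.
Unset Strict Implicit.
Unset Printing Implicit Defensive.

Import Order.TTheory GRing.Theory Num.Theory.
Import numFieldNormedType.Exports.

Local Open Scope classical_set_scope.
Local Open Scope ring_scope.
Local Open Scope quotient_scope.

(* The real projective plane: the quotient space of R^3 \ {0} (with the
   subspace topology carried by [set_type]) by proportionality. *)
Section ProjectivePlane.
Context (R : realType).

Definition nonzero_vectors : set 'rV[R]_3 := [set v | v != 0].

Definition proportional (u v : nonzero_vectors) : bool :=
  `[< exists2 c : R, c != 0 & set_val u = c *: set_val v >].

Lemma proportional_refl : reflexive proportional.
Proof. by move=> u; apply/asboolP; exists 1; rewrite ?oner_neq0 ?scale1r. Qed.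

Lemma proportional_sym : symmetric proportional.
Proof.
suff sub u v : proportional u v -> proportional v u.
  by move=> u v; apply/idP/idP; exact: sub.
move=> /asboolP[c c0 uv]; apply/asboolP; exists c^-1; first by rewrite invr_eq0.
by rewrite uv scalerA mulVf ?scale1r.
Qed.

Lemma proportional_trans : transitive proportional.
Proof.
move=> v u w /asboolP[c c0 uv] /asboolP[d d0 vw]; apply/asboolP.
by exists (c * d); rewrite ?mulf_neq0// uv vw scalerA.
Qed.

Canonical proportional_equiv :=
  EquivRel proportional proportional_refl proportional_sym proportional_trans.

Definition projective_plane : topologicalType :=
  quotient_topology {eq_quot proportional}.

End ProjectivePlane.

Section Curves.
Context (R : realType) (T : topologicalType).
Implicit Types (A B U C : set T) (x : T).

(* The circle is [0, 1] with its endpoints identified. *)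
Definition simple_closed_curve C :=
  exists f : R -> T,
    [/\ {within `[0, 1], continuous f},
        f 0 = f 1,
        {in `[0, 1[ &, injective f} &
        C = f @` `[0, 1]].

(* f restricts to a homeomorphism from U onto the whole of R^2; its values
   outside U are irrelevant. *)
Definition planar_chart U (f : T -> R * R) :=
  {within U, continuous f} /\
  exists g : R * R -> T,
    [/\ continuous g,
        forall z, U (g z),
        forall y, U y -> g (f y) = y &
        forall z, f (g z) = z].

(* A and B cross at x if near x they look, up to homeomorphism, like the two
   coordinate axes of R^2 near the origin. *)
Definition cross_at A B x :=
  exists (U : set T) (f : T -> R * R),
    [/\ open U, U x, planar_chart U f, f x = (0, 0) &
        forall y, U y -> (A y <-> (f y).2 = 0) /\ (B y <-> (f y).1 = 0)].

End Curves.

Section Arrangements.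
Context (R : realType).
Local Notation P2 := (projective_plane R).

Definition pseudoline (L : set P2) :=
  simple_closed_curve R L /\ connected (~` L).

Definition pseudoline_arrangement (F : set (set P2)) :=
  [/\ finite_set F,
      forall L, F L -> pseudoline L &
      forall L M, F L -> F M -> L <> M ->
        exists x : P2, L `&` M = [set x] /\ cross_at R L M x].

End Arrangements.

Record configuration := Configuration {
  config_point : finType;
  config_line : finType;
  incident : config_point -> config_line -> bool;
  incident_atmost1 : forall l m : config_line, l != m ->
    (#|[set p | incident p l && incident p m]%SET| <= 1)%N
}.

Definition triple_point (C : configuration) (p : config_point C) :=
  #|[set l | incident p l]%SET| = 3%N.

Definition topological_realization (R : realType) (C : configuration)
    (pt : config_point C -> projective_plane R)
    (pl : config_line C -> set (projective_plane R)) :=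
  [/\ injective pl,
      pseudoline_arrangement (range pl),
      injective pt &
      forall p l, incident p l <-> pl l (pt p)].

Definition topologically_realizable (R : realType) (C : configuration) :=
  exists pt pl, @topological_realization R C pt pl.

(* Main.v *)
(* The 26 triple points account for all 78 pairs of lines, so every crossing is
   a triple point. On the double cover S^2 of the projective plane this would be
   an arrangement with 52 vertices, 156 edges and 106 faces; as every face has at
   least three edges, 3 * 106 <= 2 * 156, which is false.

   Faces are replaced by sign vectors, so that all the topology needed is an odd,
   locally constant side function on the complement of the lift of each
   pseudoline to R^3 \ 0. Let g be a lift with g(1) = m g(0). For a point p off
   the line, the direction of g(t) seen along p is a nonvanishing complex function
   with f(1) = m f(0); its continuous square root changes by a real factor if
   m > 0, by an imaginary one if m < 0, and the sign of that factor is the side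
   of p. It is odd in p when m < 0.

   The case m > 0 is excluded because the side is then a parity of winding
   numbers: it is constant along another line M minus its intersection point with
   L, but it must change when M crosses L. This change is computed in the chart at
   the crossing, by deforming the chord from a point of M to a point of L into an
   odd function.

   Two half-circles of one line have opposite signs with respect to another line,
   so the side functions give the arrangement the combinatorics of an oriented
   matroid. The number of sign vectors is bounded below by adding the lines one
   by one, and each of them bounds at least three edges. *)
Require Import Defs.
From mathcomp Require Import all_boot all_order all_algebra zify.

Set Implicit Arguments.
Unset Strict Implicit.
Unset Printing Implicit Defensive.
Import Order.TTheory.

(** * Arrangements with triple points only *)

Section Count.
Variables (d : Order.disp_t) (T : orderType d) (Pt Ln : finType).
Variables (inc : Pt -> Ln -> bool) (meet : Ln -> Ln -> Pt).
Variables (pos : Ln -> Pt -> T) (eps : Ln -> Ln -> bool) (X : Pt -> Ln -> bool).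
Hypothesis triple : forall p, #|[set N | inc p N]| = 3.
Hypothesis meetl : forall N M, inc (meet N M) N.
Hypothesis meetr : forall N M, inc (meet N M) M.
Hypothesis meet_unique : forall p N M, N != M -> inc p N -> inc p M -> p = meet N M.
Hypothesis pos_inj : forall N p q, inc p N -> inc q N -> pos N p = pos N q -> p = q.
(* [X p M] is the side of [p] with respect to [M]. Along the line [N] it changes
   at [meet N M] only; [k] tells which of the two antipodal lifts of [p] the
   parametrization of [N] visits. *)
Hypothesis signP : forall N p, inc p N -> exists k, forall M, ~~ inc p M ->
  X p M = k (+) eps N M (+) (pos N p < pos N (meet N M))%O.

(* [(p, N, s, r)] is the edge that follows [p] on the line [N], lifted to one of
   two antipodal copies according to [s], and seen from the side [r] of [N]. *)
Let quad := (Pt * Ln * bool * bool)%type.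
Definition face (a : quad) : {ffun Ln -> bool} :=
  let: (p, N, s, r) := a in
  [ffun M => if M == N then r
             else s (+) eps N M (+) (pos N p < pos N (meet N M))%O].
Definition quads := [set a : quad | inc a.1.1.1 a.1.1.2].
(** The filler [false] outside [S] lets the sign vectors of all subarrangements live in one type. *)
Definition mask (S : {set Ln}) (w : {ffun Ln -> bool}) : {ffun Ln -> bool} :=
  [ffun M => (M \in S) && w M].
Definition topes S := [set mask S (face a) | a in quads].

(** * Lower bound for the number of sign vectors *)

Lemma pos_lt_irr N p M : N != M -> inc p N -> inc p M ->
  (pos N p < pos N (meet N M))%O = false.
Proof. by move=> NM pN pM; rewrite -(meet_unique NM pN pM) ltxx. Qed.

Definition hits (S : {set Ln}) p := [exists M in S, inc p M].

(** Look at a line of [S] through [p] and at one through [q]. If [p] and [q] had different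
    positions, the comparisons would agree at exactly one of these lines, which would force both
    [s = t] and [s != t]. *)
Lemma mask_face_inj (S : {set Ln}) N p q s t r : N \notin S ->
  inc p N -> inc q N -> hits S p -> hits S q ->
  mask S (face (p, N, s, r)) = mask S (face (q, N, t, r)) -> (p, s) = (q, t).
Proof.
move=> NS pN qN /exists_inP[M MS pM] /exists_inP[M' M'S qM'] /ffunP E.
have NM : N != M by apply: contraNneq NS => ->.
have NM' : N != M' by apply: contraNneq NS => ->.
have := E M; have := E M'; rewrite !ffunE MS M'S/=.
rewrite -!(eq_sym N) (negbTE NM) (negbTE NM').
rewrite (pos_lt_irr NM pN pM) (pos_lt_irr NM' qN qM').
rewrite -(meet_unique NM' qN qM') -(meet_unique NM pN pM).
have [e|lt|gt] := ltgtP (pos N p) (pos N q);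
  case: (eps N M); case: (eps N M'); case: s {E}; case: t => //= _ _;
  by rewrite (pos_inj pN qN).
Qed.

(** Geometrically, [N] cuts in two each region that it crosses. [B true] and [B false] are the
    restrictions of the topes on either side of [N]. Their union contains [topes S]; their
    intersection contains the vectors [D] of the edges of [N] that start at points hit by [S], which
    are distinct by [mask_face_inj]. *)
Lemma card_topes_step (S : {set Ln}) N : N \notin S ->
  #|topes S| + 2 * #|[set p | inc p N & hits S p]| <= #|topes (N |: S)|.
Proof.
move=> NS.
pose ends := [set p | inc p N & hits S p].
pose D := [set mask S (face (u.1, N, u.2, false)) | u in setX ends [set: bool]].
have cD : #|D| = 2 * #|ends|.
  rewrite card_in_imset.
    by rewrite cardsX cardsT card_bool mulnC.
  move=> [p s] [q t]; rewrite !inE/= !andbT => /andP[pN hp] /andP[qN hq].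
  exact: mask_face_inj.
rewrite -/ends -cD.
pose B b := [set mask S w | w in [set w in topes (N |: S) | w N == b]].
have maskI a : mask S (mask (N |: S) (face a)) = mask S (face a).
  by apply/ffunP => M; rewrite !ffunE !inE; case: (M \in S); rewrite ?orbT ?orbF.
have cB b : #|B b| <= #|[set w in topes (N |: S) | w N == b]|.
  exact: leq_imset_card.
have -> : #|topes (N |: S)| = #|[set w in topes (N |: S) | w N == true]| +
    #|[set w in topes (N |: S) | w N == false]|.
  rewrite -(cardsID [set w : {ffun Ln -> bool} | w N]).
  congr (_ + _); apply: eq_card => w; rewrite !inE; first by rewrite eqb_id.
  by rewrite eqbF_neg andbC.
apply: (@leq_trans (#|B true| + #|B false|)); last exact: leq_add.
rewrite -(cardsUI (B true)); apply: leq_add; apply: subset_leq_card; apply/subsetP => w.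
  move=> /imsetP[a aQ ->]; rewrite inE -!maskI.
  have aT : mask (N |: S) (face a) \in topes (N |: S) by exact: imset_f.
  apply/orP; case E: (mask (N |: S) (face a) N); [left|right];
    by apply: imset_f; rewrite inE aT E.
move=> /imsetP[[p s]]; rewrite !inE/= andbT => /andP[pN hp] ->.
have aux r : mask S (face (p, N, s, false)) \in B r.
  have -> : mask S (face (p, N, s, false)) = mask S (face (p, N, s, r)).
    apply/ffunP => M; rewrite !ffunE; case: eqP => // ->.
    by rewrite (negbTE NS).
  rewrite -maskI; apply: imset_f; rewrite inE; apply/andP; split.
    by apply: imset_f; rewrite inE.
  by rewrite !ffunE !inE eqxx.
by rewrite !aux.
Qed.

(** Lines are added one by one to a first line, which has two sides. A point contributes each time a
    line through it is added, except for the first such line; hence the predecessor. *)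
Lemma card_topes (S : {set Ln}) : S != set0 ->
  2 + 2 * \sum_p #|[set N | inc p N] :&: S|.-1 <= #|topes S|.
Proof.
have [n] := ubnP #|S|; elim: n S => // n IH S; rewrite ltnS => Sn /set0Pn[N NS].
have -> : S = N |: (S :\ N) by rewrite setD1K.
have NS' : N \notin S :\ N by rewrite !inE eqxx.
move: Sn; rewrite (cardsD1 N) NS => Sn.
have [->|S'0] := eqVneq (S :\ N) set0.
  rewrite setU0 big1 => [|p _]; last first.
    apply/eqP; rewrite -subn1 subn_eq0.
    by rewrite (leq_trans (subset_leq_card (subsetIr _ _)))// cards1.
  (* [meet N N] serves as some point of [N]. *)
  pose w r := mask [set N] (face (meet N N, N, false, r)).
  rewrite muln0 addn0.
  apply: (@leq_trans #|[set w true; w false]|).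
    rewrite cards2 ltnS lt0b; apply/eqP => /ffunP/(_ N).
    by rewrite !ffunE inE eqxx.
  have wT r : w r \in topes [set N] by apply: imset_f; rewrite inE/= meetl.
  by apply: subset_leq_card; apply/subsetP => u; rewrite !inE => /orP[]/eqP->.
apply: leq_trans (card_topes_step NS').
have /IH/(_ S'0) : #|S :\ N| < n by [].
rewrite -(leq_add2r (2 * #|[set p | inc p N & hits (S :\ N) p]|)).
apply: leq_trans; rewrite -addnA leq_add2l -mulnDr leq_mul2l/=.
rewrite -sum1dep_card [X in _ <= _ + X]big_mkcond/= -big_split/=.
apply: leq_sum => p _; rewrite setIUr.
have [pN|pN] := boolP (inc p N); last first.
  by rewrite (_ : _ :&: [set N] = set0) ?set0U ?leq_addr//;
  apply/setP => M; rewrite !inE; case: eqP => [->|]; rewrite ?andbF ?andbT ?(negbTE pN).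
have -> : [set N | inc p N] :&: [set N] = [set N].
  by apply/setP => M; rewrite !inE; case: eqP => [->|]; rewrite ?andbF ?andbT ?pN.
rewrite cardsU1 !inE eqxx/= andbF add1n/=.
case: ifP => h; first by lia.
rewrite (_ : _ :&: _ = set0) ?cards0//; apply/setP => M; rewrite !inE.
apply: contraFF h => /andP[pM MS].
by apply/exists_inP; exists M => //; rewrite !inE.
Qed.

(** * The edges around a face *)

Lemma ex_off N p : (exists N', ~~ inc p N') -> exists2 q, inc q N & q != p.
Proof.
move=> [N' pN']; exists (meet N N'); rewrite ?meetl//.
by apply: contraNneq pN' => <-; exact: meetr.
Qed.

Hypothesis off : forall p, exists N, ~~ inc p N.

(** [q] is the far end of the edge that follows [p]; seen from there the comparison becomes [<=].
    Beyond the last point of [N] the edge closes up at the first one, on the antipodal lift, whence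
    [t = ~~ s]. *)
Lemma edge_next N p s : inc p N -> exists q t, [/\ inc q N, q != p &
  forall M, s (+) (pos N p < pos N (meet N M))%O =
            t (+) (pos N q <= pos N (meet N M))%O].
Proof.
move=> pN.
have [/existsP[p1 /andP[p1N pp1]]|last] :=
    boolP [exists q, inc q N && (pos N p < pos N q)%O].
  have [|q /andP[qN pq] qmin] := @arg_minP _ _ _ p1
      (fun q => inc q N && (pos N p < pos N q)%O) (pos N).
    by rewrite p1N.
  exists q, s; split => //; first by apply: contraTneq pq => ->; rewrite ltxx.
  move=> M; congr (_ (+) _); apply/idP/idP => [lt|]; last exact: lt_le_trans.
  by apply: qmin; rewrite meetl.
have [q qN qp] := ex_off N (off p).
have [|q1 q1N q1min] := @arg_minP _ _ _ q (fun q => inc q N) (pos N); first by [].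
exists q1, (~~ s); split => //.
  apply: contraNneq last => e; apply/existsP; exists q; rewrite qN/= lt_neqAle.
  rewrite -e q1min// andbT.
  by apply: contraNneq qp => /(pos_inj q1N qN) <-; rewrite e.
move=> M; rewrite q1min ?meetl// addbT.
suff -> : (pos N p < pos N (meet N M))%O = false by rewrite addbF negbK.
by apply: contraNF last => lt; apply/existsP; exists (meet N M); rewrite meetl.
Qed.

(** A quad names an edge by the point that it follows, so the edge ending at [p] is renamed after
    its other end. Before the first point of [N] this is the last one, on the other lift. *)
Lemma edge_prev N p s : inc p N -> exists q t, inc q N /\
  forall M, s (+) (pos N p <= pos N (meet N M))%O =
            t (+) (pos N q < pos N (meet N M))%O.
Proof.
move=> pN.
have [/existsP[p1 /andP[p1N pp1]]|first] :=
    boolP [exists q, inc q N && (pos N q < pos N p)%O].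
  have [|q /andP[qN pq] qmax] := @arg_maxP _ _ _ p1
      (fun q => inc q N && (pos N q < pos N p)%O) (pos N).
    by rewrite p1N.
  exists q, s; split => //.
  move=> M; congr (_ (+) _); apply/idP/idP => [le|]; first exact: lt_le_trans le.
  by rewrite ltNge (leNgt (pos N p)); apply: contraNN => lt; apply: qmax; rewrite meetl.
have [|q1 q1N q1max] := @arg_maxP _ _ _ p (fun q => inc q N) (pos N); first by [].
exists q1, (~~ s); split => //.
move=> M; have le : (pos N (meet N M) <= pos N q1)%O by exact/q1max/meetl.
rewrite [(pos N q1 < _)%O]ltNge le/=.
suff -> : (pos N p <= pos N (meet N M))%O by rewrite addbF addbT.
rewrite leNgt; apply: contraNN first => lt; apply/existsP.
by exists (meet N M); rewrite meetl.
Qed.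

(* Compare the signs of the three lines at their traces on a line that misses [p]:
   the middle trace contributes the odd sign. *)
Lemma triple_parity p N b c : N != b -> N != c -> b != c ->
  inc p N -> inc p b -> inc p c ->
  eps N b (+) eps N c (+) (eps b N (+) eps b c) (+) (eps c N (+) eps c b).
Proof.
move=> Nb Nc bc pN pb pc; have [M0 pM] := off p.
have ne L : inc p L -> L != M0 by move=> pL; apply: contraNneq pM => <-.
have trace L L' : L != L' -> inc p L -> inc p L' -> ~~ inc (meet M0 L) L'.
  move=> LL' pL pL'; apply/negP => h; have := meetl M0 L.
  rewrite (meet_unique LL' (meetr _ _) h) -(meet_unique LL' pL pL').
  exact/negP.
(* [signP] for [L] and for [M0] describes the same sides of the point [meet M0 L]; adding the
   equations for [L1] and [L2] eliminates the unknown lifts [k] and [k']. *)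
have key L L1 L2 : L != L1 -> L != L2 -> inc p L -> inc p L1 -> inc p L2 ->
    eps L L1 (+) eps L L2 = eps M0 L1 (+) eps M0 L2 (+)
      ((pos M0 (meet M0 L) < pos M0 (meet M0 L1))%O (+)
       (pos M0 (meet M0 L) < pos M0 (meet M0 L2))%O).
  move=> LL1 LL2 pL pL1 pL2.
  have [k kP] := signP (meetr M0 L); have [k' k'P] := signP (meetl M0 L).
  have := k'P L1 (trace _ _ LL1 pL pL1); have := k'P L2 (trace _ _ LL2 pL pL2).
  rewrite !kP ?trace// -(meet_unique LL1 pL pL1) -(meet_unique LL2 pL pL2).
  move: (eps L L1) (eps L L2) (eps M0 L1) (eps M0 L2) k k' {kP k'P}.
  move: (_ < pos L p)%O (_ < pos M0 (meet M0 L1))%O (_ < pos M0 (meet M0 L2))%O.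
  by clear; do 9!case.
have [bN cN cb] : [/\ b != N, c != N & c != b] by rewrite (eq_sym b) !(eq_sym c).
rewrite (key N b c Nb Nc pN pb pc) (key b N c bN bc pb pN pc) (key c N b cN cb pc pN pb).
have pne L L' : L != L' -> inc p L -> inc p L' ->
    pos M0 (meet M0 L) != pos M0 (meet M0 L').
  move=> LL' pL pL'; apply/eqP => /(pos_inj (meetl _ _) (meetl _ _)) e.
  by have := trace _ _ LL' pL pL'; rewrite e meetr.
have := pne _ _ Nb pN pb; have := pne _ _ Nc pN pc; have := pne _ _ bc pb pc.
move: (pos M0 (meet M0 N)) (pos M0 (meet M0 b)) (pos M0 (meet M0 c)).
move: (eps M0 N) (eps M0 b) (eps M0 c); clear => e1 e2 e3 x y z.
by case: (ltgtP x y); case: (ltgtP x z); case: (ltgtP y z);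
  case: e1; case: e2; case: e3.
Qed.

(** [after] tells whether the edge of [N] at [p] follows or precedes [p]. The two edges differ only
    at the other lines through [p], as [rayE] shows. *)
Definition ray (after : bool) N p M : bool :=
  if after then (pos N p < pos N (meet N M))%O else (pos N p <= pos N (meet N M))%O.

Lemma rayE after N p M : N != M -> inc p N -> ray after N p M =
  if inc p M then ~~ after else (pos N p < pos N (meet N M))%O.
Proof.
move=> NM pN; rewrite /ray; have [pM|pM] := boolP (inc p M).
  by rewrite -(meet_unique NM pN pM) ltxx lexx; case: after.
case: after => //; rewrite le_eqVlt; case: eqP => //= e.
by rewrite (pos_inj pN (meetl _ _) e) meetr in pM.
Qed.

Lemma ray_quad after N p s r : inc p N -> exists q t, inc q N /\
  forall M, face (q, N, t, r) M =
    if M == N then r else s (+) eps N M (+) ray after N p M.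
Proof.
move=> pN; case: after; first by exists p, s; split=> // M; rewrite ffunE.
have [q [t [qN E]]] := edge_prev s pN; exists q, t; split => // M; rewrite ffunE.
case: eqP => // _; have := E M; rewrite /ray.
by case: s {E}; case: t; case: (eps N M); case: (_ < _)%O; case: (_ <= _)%O.
Qed.

Lemma three_lines p N : inc p N -> exists b c,
  [/\ N != b, N != c, b != c & [/\ inc p b, inc p c &
   forall M, inc p M -> [|| M == N, M == b | M == c]]].
Proof.
move=> pN; have := triple p; rewrite (cardsD1 N) inE pN add1n => /eqP.
rewrite eqSS => /cards2P[b [c [bc E]]].
have inE' M : (M != N) && inc p M = (M == b) || (M == c).
  by have := in_set2 M b c; rewrite -E !inE.
have /andP[bN pb] : (b != N) && inc p b by rewrite inE' eqxx.
have /andP[cN pc] : (c != N) && inc p c by rewrite inE' eqxx orbT.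
exists b, c; split => //; first by rewrite eq_sym.
  by rewrite eq_sym.
by split => // M pM; case: eqVneq => //= MN; rewrite -inE' MN.
Qed.

Definition rayface after N p s r M :=
  if M == N then r else s (+) eps N M (+) ray after N p M.

(** At the lines that miss [p], the edges on [N] and on [b] both have the signs of [p], up to the
    lift; matching them fixes [s']. The sign at [N] then fixes [after'], and the assumption on [v c]
    is what agreement at the third line requires. *)
Lemma turn_corner_to after N p s b c : N != b -> N != c -> b != c ->
  inc p N -> inc p b -> inc p c ->
  (forall M, inc p M -> [|| M == N, M == b | M == c]) ->
  forall r, let v := rayface after N p s r in
  v c = r (+) eps b N (+) eps b c ->
  exists q t, inc q b /\ forall M, face (q, b, t, v b) M = v M.
Proof.
move=> Nb Nc bc pN pb pc pE r v vc.
have [k kP] := signP pN; have [k' k'P] := signP pb.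
pose s' := k' (+) s (+) k; pose after' := ~~ (s' (+) eps b N (+) r).
have [q [t [qb E]]] := ray_quad after' s' (v b) pb.
exists q, t; split => // M; rewrite E; case: eqP => [->//|/eqP Mb].
rewrite rayE// 1?eq_sym//; case: ifP => pM.
  have := pE M pM; rewrite (negbTE Mb) => /orP[]/eqP->.
    rewrite /v /rayface eqxx /after' negbK; move: s' (eps b N) {v vc E after'} => x y.
    by case: x; case: y; case: r.
  rewrite vc /after' negbK; move: s' (eps b N) (eps b c) {v vc E after'} => x y z.
  by case: x; case: y; case: z; case: r.
have /negbT pM' := pM.
have MN : M != N by apply: contraFneq pM => ->.
rewrite /v /rayface (negbTE MN) rayE// 1?eq_sym// pM.
have := kP M pM'; rewrite k'P// /s' {v vc E after' s' kP k'P}.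
move: (_ < pos b (meet b M))%O (_ < pos N (meet N M))%O (eps b M) (eps N M) k k' s.
by clear; do 7!case.
Qed.

(** By [triple_parity], exactly one of the conditions for continuing along [b] and along [c]
    holds. *)
Lemma turn_corner after N p s r : inc p N ->
  let v := rayface after N p s r in
  exists b q t, [/\ b != N, inc p b, inc q b & forall M, face (q, b, t, v b) M = v M].
Proof.
move=> pN v; have [b [c [Nb Nc bc [pb pc pE]]]] := three_lines pN.
have [vc|vc] := eqVneq (v c) (r (+) eps b N (+) eps b c).
  have [q [t [qb E]]] := turn_corner_to Nb Nc bc pN pb pc pE vc.
  by exists b, q, t; rewrite eq_sym.
have vb : v b = r (+) eps c N (+) eps c b.
  have := triple_parity Nb Nc bc pN pb pc; move: vc.
  rewrite /v /rayface -!(eq_sym N) (negbTE Nb) (negbTE Nc) !rayE// pb pc {v}.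
  move: (eps N b) (eps N c) (eps b N) (eps b c) (eps c N) (eps c b) => x1 x2 x3 x4 x5 x6.
  by case: s; case: r; case: after; case: x1; case: x2; case: x3; case: x4;
     case: x5; case: x6.
have pE' M : inc p M -> [|| M == N, M == c | M == b].
  by move=> /pE; rewrite [(M == c) || _]orbC.
have [|q [t [qc E]]] := turn_corner_to Nc Nb _ pN pc pb pE' vb; first by rewrite eq_sym.
by exists c, q, t; rewrite eq_sym.
Qed.

(** Turning at the two ends of the given edge yields edges of the same face on lines [b] and [c].
    These differ, since otherwise [b] would meet [N] at both ends. *)
Lemma card_fiber a : a \in quads -> 3 <= #|[set a' in quads | face a' == face a]|.
Proof.
move: a => [[[p N] s] r]; rewrite inE/= => pN.
have fE M : face (p, N, s, r) M = rayface true N p s r M by rewrite ffunE.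
have [b [q1 [t1 [bN pb q1b E1]]]] := turn_corner true s r pN.
have [p' [s' [p'N p'p Es]]] := edge_next s pN.
have [c [q2 [t2 [cN p'c q2c E2]]]] := turn_corner false s' r p'N.
have f1 : face (q1, b, t1, rayface true N p s r b) = face (p, N, s, r).
  by apply/ffunP => M; rewrite fE E1.
have f2 : face (q2, c, t2, rayface false N p' s' r c) = face (p, N, s, r).
  apply/ffunP => M; rewrite fE E2 /rayface /ray; case: eqP => // _.
  by rewrite addbAC -Es addbAC.
have bc : b != c.
  apply: contraNneq p'p => bc; rewrite -bc in p'c; rewrite eq_sym in bN.
  by rewrite (meet_unique bN p'N p'c) -(meet_unique bN pN pb).
pose A : {set quad} := [set (p, N, s, r);
  (q1, b, t1, rayface true N p s r b); (q2, c, t2, rayface false N p' s' r c)].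
have <- : #|A| = 3.
  rewrite /A -setUA cardsU1 cards2 !inE !xpair_eqE.
  rewrite !(eq_sym N) (negbTE bN) (negbTE cN) (negbTE bc).
  by rewrite !(andbF, andFb).
apply/subset_leq_card/subsetP => u; rewrite !inE => /orP[/orP[]|] /eqP->.
- by rewrite eqxx pN.
- by rewrite f1 eqxx q1b.
- by rewrite f2 eqxx q2c.
Qed.

Lemma card_quads : #|quads| = 12 * #|Pt|.
Proof.
pose Q := [set u : Pt * Ln | inc u.1 u.2].
have -> : #|quads| = #|setX (setX Q [set: bool]) [set: bool]|.
  by apply: eq_card => -[[[p N] s] r]; rewrite !inE/= !andbT.
rewrite !cardsX !cardsT card_bool.
have -> : #|Q| = \sum_p #|[set N | inc p N]|.
  rewrite -sum1dep_card -(pair_big_dep xpredT (fun p N => inc p N) (fun _ _ => 1))/=.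
  by apply: eq_bigr => p _; rewrite sum1dep_card.
rewrite (eq_bigr (fun=> 3)) => [|p _]; last exact: triple.
by rewrite sum_nat_const -!mulnA mulnC.
Qed.

(** With [n] points, [card_topes] gives at least [2 + 4 * n] faces. There are [12 * n] quads (three
    lines, two lifts and two sides at each point), and each face takes at least three, so there are
    at most [4 * n] faces. *)
Lemma no_triple_arrangement : Ln -> False.
Proof.
move=> N0.
have S0 : [set: Ln] != set0 by apply/set0Pn; exists N0; rewrite inE.
have := card_topes S0.
have -> : \sum_p #|[set N | inc p N] :&: setT|.-1 = 2 * #|Pt|.
  rewrite (eq_bigr (fun=> 2)) => [|p _]; last by rewrite setIT triple.
  by rewrite sum_nat_const mulnC.
have : 3 * #|topes setT| <= #|quads|.
  have -> : topes setT = [set face a | a in quads].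
    by apply: eq_imset => a; apply/ffunP => M; rewrite ffunE inE.
  rewrite -[X in _ <= X]sum1_card (partition_big_imset face)/= mulnC -sum_nat_const.
  apply: leq_sum => w /imsetP[a aQ ->].
  by rewrite sum1dep_card; apply: card_fiber.
by rewrite card_quads; lia.
Qed.

End Count.

(** * Double counting of pairs of lines *)

Section Combinatorics.
Variables (Pt Ln : finType) (inc : Pt -> Ln -> bool).
Hypothesis atmost1 : forall l l' : Ln, l != l' ->
  (#|[set p | inc p l && inc p l']| <= 1).
Hypothesis triple : forall p, #|[set l | inc p l]| = 3.
Hypothesis count : (#|Ln| * #|Ln| = #|Ln| + 6 * #|Pt|).

(** Each point carries six ordered pairs of distinct lines, and by [atmost1] no pair occurs at two
    points. By [count] these are as many as all ordered pairs of distinct lines, so every pair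
    occurs. *)
Lemma lines_meet l l' : l != l' -> exists p, inc p l && inc p l'.
Proof.
move=> ll'.
pose A := [set x : Pt * (Ln * Ln) | [&& x.2.1 != x.2.2, inc x.1 x.2.1 & inc x.1 x.2.2]].
pose B := [set y : Ln * Ln | y.1 != y.2].
have diag (D : {set Ln}) : #|[set (u, u) | u in D]| = #|D|.
  by apply: card_imset => x y [].
have cB : (#|B| + #|Ln| = #|Ln| * #|Ln|).
  rewrite -card_prod -(cardC (mem B)) -(cardsT Ln) -(diag setT); congr (_ + _).
  apply: eq_card => -[x y]; rewrite !inE/= negbK.
  by apply/imsetP/eqP => [[z _ [-> ->]//]|->]; exists y.
have cA : #|A| = (6 * #|Pt|).
  have -> : #|A| = (\sum_p #|[set y : Ln * Ln | [&& y.1 != y.2, inc p y.1 & inc p y.2]]|).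
    rewrite -sum1dep_card.
    rewrite -(pair_big_dep xpredT (fun p (y : Ln * Ln) => [&& y.1 != y.2, inc p y.1 & inc p y.2])
      (fun _ _ => 1))/=.
    by apply: eq_bigr => p _; rewrite sum1dep_card.
  rewrite (eq_bigr (fun=> 6)) => [|p _]; first by rewrite sum_nat_const mulnC.
  pose D := [set l | inc p l].
  have cD : #|D| = 3 by exact: triple.
  have e : (#|[set y : Ln * Ln | [&& y.1 != y.2, inc p y.1 & inc p y.2]]| + #|D| =
      #|setX D D|).
    rewrite -(cardsID [set y : Ln * Ln | y.1 != y.2] (setX D D)); congr (_ + _).
      by apply: eq_card => -[x y]; rewrite !inE/= andbC.
    rewrite -(diag D); apply: eq_card => -[x y]; rewrite !inE/= negbK.
    apply/imsetP/andP => [[z zD [-> ->]]|[/eqP -> /andP[yD _]]].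
      by rewrite inE in zD; rewrite zD eqxx.
    by exists y; rewrite ?inE.
  by apply/eqP; rewrite -(eqn_add2r 3) -{1}cD e cardsX cD.
have inj : {in A &, injective (fun x : Pt * (Ln * Ln) => x.2)}.
  move=> [p y] [q z]; rewrite !inE/= => /and3P[ne p1 p2] /and3P[_ q1 q2] yz.
  rewrite -yz in q1 q2 *; congr (_, _); apply/eqP/negPn/negP => pq.
  have := atmost1 ne; rewrite leqNgt => /negP; apply.
  have <- : #|[set p; q]| = 2 by rewrite cards2 pq.
  by apply: subset_leq_card; apply/subsetP => u; rewrite !inE => /orP[]/eqP->; apply/andP.
have sub : [set x.2 | x in A] \subset B.
  by apply/subsetP => _ /imsetP[x + ->]; rewrite !inE => /and3P[].
have /eqP AB : [set x.2 | x in A] == B.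
  rewrite eqEcard sub card_in_imset// cA -(leq_add2r #|Ln|) cB count addnC.
  exact: leqnn.
have : (l, l') \in B by rewrite inE.
rewrite -AB => /imsetP[[p y]]; rewrite inE/= => /and3P[_ h1 h2] e.
by exists p; move: h1 h2; rewrite -e /= => -> ->.
Qed.

End Combinatorics.

(** * Auxiliary points and lines *)

Section Existence.
Variables (Pt Ln : finType) (inc : Pt -> Ln -> bool).
Hypothesis triple : forall p, #|[set l | inc p l]| = 3.
Hypothesis card_lines : 3 < #|Ln|.

Lemma off_point p : exists l, ~~ inc p l.
Proof.
apply/existsP; rewrite -negb_forall; apply: contraTN card_lines => /forallP H.
rewrite -leqNgt -(triple p) subset_leq_card//.
by apply/subsetP => l _; rewrite inE.
Qed.

Lemma through_point p l : exists2 l', l' != l & inc p l'.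
Proof.
have /existsP[l' /andP[]] : [exists l', (l' != l) && inc p l']; last by exists l'.
apply: contraTT isT => /existsPn H.
have : #|[set l' | inc p l']| <= #|[set l]|.
  apply/subset_leq_card/subsetP => l'; rewrite !inE => pl'.
  by have := H l'; rewrite pl' andbT negbK.
by rewrite triple cards1.
Qed.

Hypothesis lines_meet : forall l l' : Ln, l != l' -> exists p, inc p l && inc p l'.

Lemma on_line l : exists p, inc p l.
Proof.
have [l' ll'] : exists l', l' != l.
  apply/existsP; apply: contraTT card_lines => /existsPn H; rewrite -leqNgt.
  apply: (@leq_trans #|[set l]|); last by rewrite cards1.
  by apply/subset_leq_card/subsetP => l' _; have := H l'; rewrite inE negbK.
by have [p /andP[_ pl']] := lines_meet ll'; exists p.
Qed.

End Existence.

From mathcomp Require Import complex ring lra.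
From mathcomp Require Import all_classical all_reals all_analysis.

Import GRing.Theory Num.Theory.
Import numFieldNormedType.Exports.
Local Open Scope classical_set_scope.
Local Open Scope ring_scope.
Local Open Scope complex_scope.

(** * Continuous square roots of complex functions *)

Section Rootc.
Variable R : realType.
Implicit Types z w : R[i].
Local Notation Re := (@complex.Re R).
Local Notation Im := (@complex.Im R).

Lemma cReM z w : Re (z * w) = Re z * Re w - Im z * Im w.
Proof. by case: z w => [a b] [c d]. Qed.
Lemma cImM z w : Im (z * w) = Re z * Im w + Im z * Re w.
Proof. by case: z w => [a b] [c d]. Qed.
Lemma cReJ z : Re z^*%C = Re z. Proof. by case: z. Qed.
Lemma cImJ z : Im z^*%C = - Im z. Proof. by case: z. Qed.
Lemma conjcM z w : (z * w)^*%C = z^*%C * w^*%C. Proof. exact: rmorphM. Qed.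
Lemma gt0_complex z : (0 < z) = (Im z == 0) && (0 < Re z).
Proof. by rewrite ltcE /= eq_sym. Qed.
Lemma complex_neq0 z : (z != 0) = (0 < Re z ^+ 2 + Im z ^+ 2).
Proof.
case: z => a b; rewrite eq_complex/= negb_and lt0r paddr_eq0 ?sqr_ge0// !sqrf_eq0.
by rewrite addr_ge0 ?sqr_ge0// andbT negb_and.
Qed.
Lemma mulcJ_gt0 z : z != 0 -> 0 < z * z^*%C.
Proof.
rewrite complex_neq0 => h; rewrite gt0_complex cReM cImM cReJ cImJ.
by apply/andP; split; [apply/eqP; ring | move: h; congr (_ < _); ring].
Qed.

(* [w] is a square root of [z] up to a positive factor. *)
Definition rootc z w := 0 < w ^+ 2 * z^*%C.

Lemma rootcM z w z' w' : rootc z w -> rootc z' w' -> rootc (z * z') (w * w').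
Proof. by move=> h h'; rewrite /rootc exprMn conjcM mulrACA mulr_gt0. Qed.

Lemma rootc_conj z w : rootc z w -> rootc z^*%C w^*%C.
Proof.
rewrite /rootc expr2 => h.
suff -> : w^*%C ^+ 2 * (z^*)^*%C = (w * w * z^*)^*%C.
  by move: h; rewrite !gt0_complex cReJ cImJ oppr_eq0.
by rewrite !conjcM expr2.
Qed.

Lemma rootc_neq0 z w : rootc z w -> (z != 0) * (w != 0).
Proof.
rewrite /rootc => h; split; apply: contraTneq h => ->.
  by rewrite conjc0 mulr0 ltxx.
by rewrite expr0n mul0r ltxx.
Qed.

Lemma rootc_exists z : z != 0 -> exists w, rootc z w.
Proof. by move=> z0; exists (sqrtc z); rewrite /rootc sqr_sqrtc mulcJ_gt0. Qed.

Lemma rootc_scale (x : R[i]) z w : 0 < x -> rootc (x * z) w = rootc z w.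
Proof.
move=> x0; rewrite /rootc conjcM.
have -> : x^*%C = x.
  by move: x0; rewrite gt0_complex; case: x => a b /= /andP[/eqP-> _]; rewrite oppr0.
by rewrite mulrCA pmulr_rgt0.
Qed.

(** The product of [w'] and the conjugate of [w] has a positive square, so it is real. Thus a root
    is unique up to a real factor, and only the sign of this factor matters later. *)
Lemma rootc_parallel z w w' : rootc z w -> rootc z w' ->
  Im (w' * w^*%C) = 0 /\ Re (w' * w^*%C) != 0.
Proof.
move=> h h'; have [z0 _] := rootc_neq0 h.
have : 0 < (w' * w^*%C) ^+ 2.
  have := rootcM h' (rootc_conj h).
  have := mulcJ_gt0 z0 => p; rewrite -[z * _]mulr1 rootc_scale//.
  by rewrite /rootc conjc1 mulr1.
move: (w' * _) => [a b]; rewrite expr2 gt0_complex cReM cImM /= => /andP[/eqP e p].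
have : a * b = 0 by move: e; lra.
move/eqP; rewrite mulf_eq0 => /orP[]/eqP h0; last first.
  by split => //; apply: contraTneq p => ->; rewrite h0; lra.
by move: p; rewrite h0 mul0r sub0r -expr2 oppr_gt0 ltNge sqr_ge0.
Qed.

(** [w ^+ 2] is a positive multiple of [z], so [w] lies within 45 degrees of the real axis. *)
Lemma rootc_Re z w : 0 < Re z -> rootc z w -> Im w ^+ 2 < Re w ^+ 2.
Proof.
case: z w => [a b] [c d]; rewrite /rootc gt0_complex !(cReM, cImM, expr2) /= => a0.
move=> /andP[/eqP e p].
rewrite -subr_gt0 -(pmulr_rgt0 _ (_ : 0 < a ^+ 2 + b ^+ 2)); last first.
  by rewrite ltr_wpDr ?sqr_ge0// exprn_gt0.
have -> : (a ^+ 2 + b ^+ 2) * (c * c - d * d) =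
  a * ((c * c - d * d) * a - (c * d + d * c) * - b) +
  - b * ((c * c - d * d) * - b + (c * d + d * c) * a) by ring.
by rewrite e mulr0 addr0 mulr_gt0.
Qed.

Definition abs z : R := Num.sqrt (Re z ^+ 2 + Im z ^+ 2).

(** Adding the modulus halves the argument, which gives a continuous choice of root on the right
    half-plane. *)
Definition sqrt_dir z : R[i] := z + (abs z)%:C.

Lemma abs_gt0 z : z != 0 -> 0 < abs z /\ abs z ^+ 2 = Re z ^+ 2 + Im z ^+ 2.
Proof. by rewrite complex_neq0 /abs => h; rewrite sqrtr_gt0 sqr_sqrtr// ltW. Qed.

Lemma rootc_sqrt_dir z : 0 < Re z -> rootc z (sqrt_dir z).
Proof.
move=> h; have z0 : z != 0 by rewrite complex_neq0 ltr_wpDr ?sqr_ge0// exprn_gt0.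
have [n0 n2] := abs_gt0 z0; move: n0 n2 h; rewrite /rootc /sqrt_dir.
move: (abs z) => n; case: z {z0} => a b n0 /= n2 a0.
rewrite gt0_complex !(cReM, cImM, expr2)/=; apply/andP; split.
  apply/eqP; transitivity (b * ((a ^+ 2 + b ^+ 2) - n ^+ 2)); first by ring.
  by rewrite n2 subrr mulr0.
have -> : ((a + n) * (a + n) - (b + 0) * (b + 0)) * a -
  ((a + n) * (b + 0) + (b + 0) * (a + n)) * - b =
  (a ^+ 2 + b ^+ 2) * (a + 2 * n) + a * n ^+ 2 by ring.
by rewrite -n2 addr_gt0// mulr_gt0 ?exprn_gt0// addr_gt0 ?mulr_gt0.
Qed.

Lemma Re_sqrt_dir z : 0 < Re z -> 0 < Re (sqrt_dir z).
Proof.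
move=> h; have z0 : z != 0 by rewrite complex_neq0 ltr_wpDr ?sqr_ge0// exprn_gt0.
by have [n0 _] := abs_gt0 z0; case: z h n0 {z0} => a b /= h n0; rewrite addr_gt0.
Qed.

End Rootc.

Section Ccont.
Variable R : realType.
Local Notation Re := (@complex.Re R).
Local Notation Im := (@complex.Im R).

Definition ccont (T : topologicalType) (f : T -> R[i]) :=
  continuous (fun x => Re (f x)) /\ continuous (fun x => Im (f x)).

Lemma ccontM (T : topologicalType) (f g : T -> R[i]) :
  ccont f -> ccont g -> ccont (fun x => f x * g x).
Proof.
move=> [f1 f2] [g1 g2]; split => x.
  under eq_fun do rewrite cReM.
  by apply: cvgB; apply: cvgM; [exact: f1|exact: g1|exact: f2|exact: g2].
under eq_fun do rewrite cImM.
by apply: cvgD; apply: cvgM; [exact: f1|exact: g2|exact: f2|exact: g1].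
Qed.

Lemma ccontD (T : topologicalType) (f g : T -> R[i]) :
  ccont f -> ccont g -> ccont (fun x => f x + g x).
Proof.
move=> [f1 f2] [g1 g2]; split => x; under eq_fun do rewrite raddfD.
  by apply: cvgD; [exact: f1|exact: g1].
by apply: cvgD; [exact: f2|exact: g2].
Qed.

Lemma ccont_conj (T : topologicalType) (f : T -> R[i]) :
  ccont f -> ccont (fun x => (f x)^*%C).
Proof.
move=> [f1 f2]; split => x; first by under eq_fun do rewrite cReJ; exact: f1.
by under eq_fun do rewrite cImJ; apply: cvgN; exact: f2.
Qed.

Lemma ccont_cst (T : topologicalType) (z : R[i]) : ccont (fun _ : T => z).
Proof. by split => x; apply: cvg_cst. Qed.

Lemma ccont_comp (S T : topologicalType) (g : S -> T) (f : T -> R[i]) :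
  continuous g -> ccont f -> ccont (fun x => f (g x)).
Proof.
move=> gc [f1 f2]; split => x.
  exact: (continuous_comp (gc x) (f1 (g x))).
exact: (continuous_comp (gc x) (f2 (g x))).
Qed.

Lemma ccont_sqrt_dir (T : topologicalType) (f : T -> R[i]) :
  ccont f -> ccont (fun x => sqrt_dir (f x)).
Proof.
move=> [f1 f2]; split => x; rewrite /sqrt_dir; last first.
  have -> : (fun x => Im (f x + (abs (f x))%:C)) = fun x => Im (f x).
    by apply: funext => y; case: (f y) => a b /=; rewrite addr0.
  exact: f2.
have -> : (fun x => Re (f x + (abs (f x))%:C)) = fun x => Re (f x) +
   Num.sqrt (Re (f x) * Re (f x) + Im (f x) * Im (f x)).
  by apply: funext => y; rewrite /abs; case: (f y) => a b /=; rewrite !expr2.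
apply: cvgD; first exact: f1.
have hc : continuous (fun x => Re (f x) * Re (f x) + Im (f x) * Im (f x)).
  by move=> y; apply: cvgD; apply: cvgM; [exact: f1|exact: f1|exact: f2|exact: f2].
exact: (continuous_comp (hc x) (@sqrt_continuous R _)).
Qed.

Lemma ccont_prod (T : topologicalType) n (f : 'I_n -> T -> R[i]) :
  (forall i, ccont (f i)) -> ccont (fun x => \prod_(i < n) f i x).
Proof.
elim: n f => [|n IH] f fc.
  by under eq_fun do rewrite big_ord0; exact: ccont_cst.
under eq_fun do rewrite big_ord_recr.
by apply: ccontM => //; exact: IH.
Qed.

End Ccont.

(** * Roots along an interval *)

Section RootOn.
Variable R : realType.
Local Notation Re := (@complex.Re R).
Local Notation Im := (@complex.Im R).
Implicit Types (f g h : R -> R[i]) (a b s t : R).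

(** Tube lemma: compactness of the segment makes the neighbourhood of [u0] uniform in [t]. *)
Lemma near_segment (Q : R -> R -> R) a b u0 :
  continuous (fun z : R * R => Q z.1 z.2) ->
  (forall t, a <= t <= b -> 0 < Q t u0) ->
  \forall u \near u0, forall t, a <= t <= b -> 0 < Q t u.
Proof.
move=> Qc Q0.
have cpt : compact `[a, b] by exact: segment_compact.
have /compact_near_coveringP/(_ R (nbhs u0) (fun u t => 0 < Q t u) _) H := cpt.
apply: filterS (H _) => [u Hu t tab|t /=]; first by apply: Hu; rewrite /= in_itv.
rewrite in_itv/= => tab.
exact: (cvgr_gt _ (Qc (t, u0)) _ (Q0 _ tab)).
Qed.

Lemma min_cont (c : R) : continuous (fun t : R => Order.min t c).
Proof.
move=> t; apply: (@continuous_min R R (fun t => t) (fun=> c)).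
  exact: cvg_id.
exact: cvg_cst.
Qed.

Lemma max_cont (c : R) : continuous (fun t : R => Order.max c t).
Proof.
move=> t; apply: (@continuous_max R R (fun=> c) (fun t => t)); first exact: cvg_cst.
exact: cvg_id.
Qed.

(** Retraction onto the segment; composing with it turns continuity on the segment into continuity
    on [R]. *)
Definition clamp a b t := Order.max a (Order.min t b).

Lemma clamp_cont a b : continuous (clamp a b).
Proof. move=> t; apply: (@continuous_comp _ _ _ (fun t => Order.min t b) (fun t => Order.max a t)).
  exact: min_cont.
exact: max_cont. Qed.

Lemma clamp_in a b t : a <= b -> a <= clamp a b t <= b.
Proof. by move=> ab; rewrite /clamp le_max lexx ge_max ab ge_min lexx orbT. Qed.

Lemma clamp_id a b t : a <= t <= b -> clamp a b t = t.
Proof. by move=> /andP[at' tb]; rewrite /clamp min_l// max_r. Qed.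

Lemma within_clamp (T : topologicalType) a b (f : R -> T) : a <= b ->
  {within `[a, b], continuous f} -> continuous (fun t => f (clamp a b t)).
Proof.
move=> ab /subspace_continuousP fc t V.
have cab := clamp_in t ab.
have /fc/[apply] : `[a, b]%classic (clamp a b t) by rewrite /= in_itv.
move=> W.
have {}W : \forall s \near t, `[a, b]%classic (clamp a b s) -> V (f (clamp a b s)).
  exact: clamp_cont W.
by apply: filterS W => s; apply; rewrite /= in_itv/=; exact: clamp_in.
Qed.

Lemma const_sign (u : R -> R) a b :
  (forall t, a <= t <= b -> {for t, continuous u}) ->
  (forall t, a <= t <= b -> u t != 0) ->
  forall s t, a <= s <= b -> a <= t <= b -> 0 < u s * u t.
Proof.
move=> uc u0 s t sab tab; wlog st : s t sab tab / s <= t.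
  by move=> H; have [/H|/ltW/H] := leP s t; [exact|rewrite mulrC; exact].
have sub c : s <= c <= t -> a <= c <= b.
  move/andP: sab => [? ?]; move/andP: tab => [? ?] /andP[? ?].
  by apply/andP; split; lra.
rewrite ltNge; apply/negP => le0.
have [] := @IVT R u s t 0 st.
- apply: continuous_in_subspaceT => c; rewrite inE/= in_itv/= => cst.
  exact/uc/sub.
- have us := u0 _ sab; have ut := u0 _ tab; rewrite ge_min le_max.
  move: us ut le0; rewrite !neq_lt => /orP[] us /orP[] ut le0.
  + by have := nmulr_rgt0 (u t) us; rewrite ut ltNge le0.
  + by rewrite (ltW us) (ltW ut) orbT.
  + by rewrite (ltW us) (ltW ut) orbT.
  + by have := mulr_gt0 us ut; rewrite ltNge le0.
move=> c; rewrite in_itv/= => cst /eqP.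
by rewrite (negbTE (u0 _ (sub _ cst))).
Qed.

Lemma const_bool (g : R -> bool) a b :
  (forall t, a <= t <= b -> \forall t' \near t, g t' = g t) ->
  forall s t, a <= s <= b -> a <= t <= b -> g s = g t.
Proof.
move=> gc s t sab tab; pose u t : R := if g t then 1 else - 1.
have : 0 < u s * u t.
  apply: (@const_sign u a b) => // {sab tab s t} t tab; last first.
    by rewrite /u; case: ifP => _; rewrite ?oppr_eq0 oner_eq0.
  by apply: cvg_near_cst; apply: filterS (gc t tab) => t' e; rewrite /u e.
by rewrite /u; case: (g s); case: (g t) => //; rewrite ?mul1r ?mulr1 oppr_gt0 ltr10.
Qed.

Definition root_on a b f h := ccont h /\ forall t, a <= t <= b -> rootc (f t) (h t).

Lemma root_on_exists a b f : a <= b -> ccont f ->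
  (forall t, a <= t <= b -> f t != 0) -> exists h, root_on a b f h.
Proof.
move=> ab fc f0.
(* Telescoping product of direct square roots of quotients of close values. *)
have [e e0 He] : exists2 e : R, 0 < e & forall d t, `|d| < e -> a <= t <= b ->
    0 < Re (f (t + d) * (f t)^*%C).
  have [||e e0 He] := @near_segment (fun t d => Re (f (t + d) * (f t)^*%C)) a b 0.
  - suff [] : ccont (fun z : R * R => f (z.1 + z.2) * (f z.1)^*%C) by [].
    apply: ccontM; first by apply: ccont_comp fc => z; exact: add_continuous.
    by apply: ccont_conj; apply: ccont_comp fc => z; exact: cvg_fst.
  - move=> t tab; rewrite addr0.
    by have := mulcJ_gt0 (f0 t tab); rewrite gt0_complex => /andP[].
  by exists e => // d t de tab; apply: (He d) => //=; rewrite sub0r normrN.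
have [n nP] : exists n, (b - a) / n.+1%:R < e.
  exists (Num.bound ((b - a) / e)); rewrite ltr_pdivrMr// mulrC -ltr_pdivrMr//.
  rewrite (lt_le_trans (archi_boundP _)) ?ler_nat// divr_ge0 ?subr_ge0//.
  exact: ltW.
pose c := (b - a) / n.+1%:R.
have c0 : 0 <= c by rewrite divr_ge0// subr_ge0.
(* [t] is stopped at the [k]-th node. Consecutive values are less than [e] apart, the first is [a]
   and the last is [t] itself. *)
pose m (k : nat) t := Order.min t (a + c * k%:R).
have mab k t : a <= t <= b -> a <= m k t <= b.
  move=> /andP[at' tb]; rewrite le_min at' ge_min tb !andbT/= lerDl.
  by rewrite mulr_ge0.
have [|w0 w0P] := @rootc_exists _ (f a); first by rewrite f0// lexx ab.
pose r (j : nat) t := w0 * \prod_(k < j) sqrt_dir (f (m k.+1 t) * (f (m k t))^*%C).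
have hP j t : a <= t <= b -> rootc (f (m j t)) (r j t).
  move=> tab; elim: j => [|j IH].
    by rewrite /r big_ord0 mulr1 /m mulr0 addr0 min_r//; case/andP: tab.
  rewrite /r big_ord_recr/= mulrA -/(r j t).
  rewrite -(rootc_scale _ _ (mulcJ_gt0 (f0 _ (mab j t tab)))) -mulrA.
  rewrite [_^*%C * _]mulrC; apply: rootcM => //; apply: rootc_sqrt_dir.
  have := He (m j.+1 t - m j t) (m j t) _ (mab j t tab).
  rewrite subrKC; apply.
  apply: le_lt_trans nP; rewrite -/c.
  have cj : a + c * j.+1%:R = a + c * j%:R + c by rewrite -natr1; ring.
  rewrite /m cj; move: (a + c * j%:R) c0 => x; move: (c) => y y0; rewrite ler_norml.
  by have [?|?] := leP t x; have [?|?] := leP t (x + y); apply/andP; split; lra.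
exists (r n.+1); split.
  apply: ccontM; first exact: ccont_cst.
  apply: ccont_prod => i; apply: ccont_sqrt_dir; apply: ccontM.
    apply: ccont_comp fc => t.
    exact: min_cont.
  apply: ccont_conj; apply: ccont_comp fc => t.
  exact: min_cont.
move=> t tab; have := hP n.+1 t tab; congr rootc; congr f.
rewrite /m min_l// /c divfK ?pnatr_eq0// subrKC.
by case/andP: tab.
Qed.

Lemma root_on_unique a b f h k : root_on a b f h -> root_on a b f k ->
  forall s t, a <= s <= b -> a <= t <= b ->
  0 < Re (k s * (h s)^*%C) * Re (k t * (h t)^*%C).
Proof.
move=> [hc hP] [kc kP]; apply: (@const_sign (fun t => Re (k t * (h t)^*%C))).
  have [kh _] := ccontM kc (ccont_conj hc); move=> t _; exact: kh.
by move=> t tab; have [] := rootc_parallel (hP t tab) (kP t tab).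
Qed.

(** The two roots differ by a real factor of constant sign, which cancels in the product. *)
Lemma root_on_Re_sign a b f h k s t : root_on a b f h -> root_on a b f k ->
  a <= s <= b -> a <= t <= b -> (0 < Re (h s) * Re (h t)) = (0 < Re (k s) * Re (k t)).
Proof.
suff imp h' k' : root_on a b f h' -> root_on a b f k' -> a <= s <= b -> a <= t <= b ->
    0 < Re (h' s) * Re (h' t) -> 0 < Re (k' s) * Re (k' t).
  by move=> hP kP sab tab; apply/idP/idP;
    [exact: (imp h k hP kP sab tab)|exact: (imp k h kP hP sab tab)].
move=> hP kP sab tab; have u := root_on_unique kP hP sab tab.
have rl c : a <= c <= b -> exists2 d : R, 0 < d &
    d * Re (h' c) = Re (h' c * (k' c)^*%C) * Re (k' c).
  move=> cab; have [e _] := rootc_parallel (kP.2 _ cab) (hP.2 _ cab).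
  have [_ k0] := rootc_neq0 (kP.2 _ cab).
  exists (Re (k' c) ^+ 2 + Im (k' c) ^+ 2); first by rewrite -complex_neq0.
  transitivity (Re (h' c * (k' c)^*%C * k' c)); last by rewrite cReM e mul0r subr0.
  by rewrite !(cReM, cImM, cReJ, cImJ); ring.
have [c c0 ce] := rl _ sab; have [d d0 de] := rl _ tab => H.
rewrite -(pmulr_rgt0 _ u).
have := mulr_gt0 (mulr_gt0 c0 d0) H.
by rewrite mulrACA ce de => {}H; rewrite mulrACA.
Qed.

(** The direction of [g] relative to [f] stays in the right half-plane, where [sqrt_dir] provides a
    root without any choice. *)
Lemma root_on_deform a b f g h : ccont f -> ccont g ->
  (forall t, a <= t <= b -> 0 < Re (g t * (f t)^*%C)) -> root_on a b f h ->
  root_on a b g (fun t => h t * sqrt_dir (g t * (f t)^*%C)).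
Proof.
move=> fc gc fg [hc hP]; split=> [|t tab].
  apply: ccontM => //; apply: ccont_sqrt_dir; apply: ccontM => //; exact: ccont_conj.
have [f0 _] := rootc_neq0 (hP t tab).
rewrite -(rootc_scale _ _ (mulcJ_gt0 f0)) -mulrA [_^*%C * _]mulrC.
by apply: rootcM; [exact: hP|exact/rootc_sqrt_dir/fg].
Qed.

End RootOn.

(** * Monodromy of the square root *)

Section Turn.
Variable R : realType.
Local Notation Re := (@complex.Re R).
Local Notation Im := (@complex.Im R).
Implicit Types (f g h : R -> R[i]) (t : R) (p v : 'rV[R]_3).

(* If [f 1] is a real multiple of [f 0], then [h 1 / h 0] is real or imaginary;
   [turn f] is its sign in both cases. *)
Definition turn f := `[< exists h, root_on 0 1 f h /\
  0 < Re (h 1 * (h 0)^*%C) + Im (h 1 * (h 0)^*%C) >].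

Lemma gt0_scale_ReIm (a z w : R[i]) : 0 < a -> w = a * z ->
  (0 < Re w + Im w) = (0 < Re z + Im z).
Proof.
rewrite gt0_complex => /andP[/eqP ia ra] ->; rewrite cReM cImM ia !mul0r subr0 addr0.
by rewrite -mulrDr pmulr_rgt0.
Qed.

(** Another root differs by a real factor of constant sign, which changes [h 1] times the conjugate
    of [h 0] by a positive factor. *)
Lemma turnE f h : root_on 0 1 f h ->
  turn f = (0 < Re (h 1 * (h 0)^*%C) + Im (h 1 * (h 0)^*%C)).
Proof.
move=> hP; apply/asboolP/idP => [[k [kP]]|h0]; last by exists h.
have i0 : 0 <= (0 : R) <= 1 by apply/andP; split; lra.
have i1 : 0 <= (1 : R) <= 1 by apply/andP; split; lra.
have u := root_on_unique hP kP i1 i0.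
have [_ h0] := rootc_neq0 (hP.2 _ i0); have [_ h1] := rootc_neq0 (hP.2 _ i1).
have [e0 _] := rootc_parallel (hP.2 _ i0) (kP.2 _ i0).
have [e1 _] := rootc_parallel (hP.2 _ i1) (kP.2 _ i1).
have N0 := mulr_gt0 (mulcJ_gt0 h0) (mulcJ_gt0 h1).
have M0 : 0 < (k 1 * (h 1)^*%C) * (k 0 * (h 0)^*%C)^*%C.
  move: (k 1 * _) (k 0 * _) e0 e1 u => [x y] [x' y'] /= -> ->.
  by rewrite gt0_complex/= !(oppr0, mulr0, mul0r, addr0, subr0) eqxx.
rewrite -(gt0_scale_ReIm N0 erefl) => H.
rewrite -(gt0_scale_ReIm M0 erefl); move: H; congr (0 < Re _ + Im _).
  rewrite !conjcM conjcK; ring.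
rewrite !conjcM conjcK; ring.
Qed.

(** The factor supplied by [root_on_deform] is multiplied by [m ^+ 2] along the loop, and this is
    positive. *)
Lemma turn_deform f g (m : R) : m != 0 -> ccont f -> ccont g ->
  f 1 = m%:C * f 0 -> g 1 = m%:C * g 0 ->
  (forall t, 0 <= t <= 1 -> 0 < Re (g t * (f t)^*%C)) -> turn g = turn f.
Proof.
move=> m0 fc gc f1 g1 fg.
have [t tab|h hP] := @root_on_exists _ 0 1 f ler01 fc.
  apply/eqP => ft; have := fg t tab; rewrite ft conjc0 mulr0.
  by rewrite ltxx.
rewrite (turnE hP) (turnE (root_on_deform fc gc fg hP)).
have e : sqrt_dir (g 1 * (f 1)^*%C) = (m ^+ 2)%:C * sqrt_dir (g 0 * (f 0)^*%C).
  rewrite f1 g1 conjcM conjc_real.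
  have -> : m%:C * g 0 * (m%:C * (f 0)^*%C) = (m ^+ 2)%:C * (g 0 * (f 0)^*%C).
    by rewrite rmorphXn/=; ring.
  move: (g 0 * _) => z; rewrite /sqrt_dir mulrDr -rmorphM/=; congr (_ + _%:C).
  rewrite /abs cReM cImM /= !mul0r subr0 addr0.
  have -> : (m ^+ 2 * Re z) ^+ 2 + (m ^+ 2 * Im z) ^+ 2 =
     (m ^+ 2) ^+ 2 * (Re z ^+ 2 + Im z ^+ 2) by ring.
  by rewrite sqrtrM ?sqr_ge0// sqrtr_sqr ger0_norm// sqr_ge0.
apply: (@gt0_scale_ReIm ((m ^+ 2)%:C *
  (sqrt_dir (g 0 * (f 0)^*%C) * (sqrt_dir (g 0 * (f 0)^*%C))^*%C))).
  rewrite mulr_gt0//; first by rewrite ltcR lt0r sqrf_eq0 m0 sqr_ge0.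
  apply: mulcJ_gt0; have i0 : 0 <= (0 : R) <= 1 by apply/andP; split; lra.
  have H := Re_sqrt_dir (fg 0 i0); apply: contraTneq H => ->.
  by rewrite ltxx.
by rewrite e !conjcM; ring.
Qed.

Lemma turn_scale f (a : R[i]) : a != 0 -> ccont f ->
  (forall t, 0 <= t <= 1 -> f t != 0) -> turn (fun t => a * f t) = turn f.
Proof.
move=> a0 fc f0; have [h hP] := root_on_exists ler01 fc f0.
have [w wP] := rootc_exists a0; have [_ w0] := rootc_neq0 wP.
have whP : root_on 0 1 (fun t => a * f t) (fun t => w * h t).
  split; first by apply: ccontM; [exact: ccont_cst|exact: hP.1].
  by move=> t tab; apply: rootcM => //; exact: hP.2.
rewrite (turnE hP) (turnE whP).
apply: (gt0_scale_ReIm (mulcJ_gt0 w0)).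
by rewrite conjcM; ring.
Qed.

(** Conjugation keeps a real factor and negates an imaginary one; the factor is imaginary exactly
    when [m < 0]. *)
Lemma turn_conj f (m : R) : m != 0 -> ccont f -> f 1 = m%:C * f 0 ->
  (forall t, 0 <= t <= 1 -> f t != 0) ->
  turn (fun t => (f t)^*%C) = turn f (+) (m < 0).
Proof.
move=> m0 fc f1 f0; have [h hP] := root_on_exists ler01 fc f0.
have hjP : root_on 0 1 (fun t => (f t)^*%C) (fun t => (h t)^*%C).
  split; first by apply: ccont_conj hP.1.
  by move=> t tab; apply: rootc_conj; exact: hP.2.
rewrite (turnE hP) (turnE hjP) -conjcM cReJ cImJ.
have i0 : 0 <= (0 : R) <= 1 by apply/andP; split; lra.
have i1 : 0 <= (1 : R) <= 1 by apply/andP; split; lra.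
have := rootcM (hP.2 _ i1) (rootc_conj (hP.2 _ i0)).
rewrite f1 -mulrA mulrC rootc_scale; last exact/mulcJ_gt0/f0.
rewrite /rootc conjc_real; move: (h 1 * _) => [a b].
rewrite gt0_complex !(cReM, cImM, expr2)/= => /andP[/eqP ab p].
have {p} p : 0 < (a * a - b * b) * m by move: p; lra.
have : a * b = 0 by apply: (mulIf m0); rewrite mul0r; move: ab; lra.
move/eqP; rewrite mulf_eq0 => /orP[]/eqP h0; move: p; rewrite h0.
  rewrite mul0r sub0r !add0r => bm.
  have b0 : b != 0 by apply: contraTneq bm => ->; rewrite mulr0 oppr0 mul0r ltxx.
  have mn : m < 0.
    rewrite ltNge; apply: contraTN bm => m1.
    by rewrite -leNgt mulNr oppr_le0 mulr_ge0// -expr2 sqr_ge0.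
  by rewrite mn addbT; move: b0; rewrite neq_lt oppr_gt0; case: ltgtP.
rewrite mul0r subr0 oppr0 => am.
have -> : (m < 0) = false.
  apply: contraTF am => m1; rewrite -leNgt mulr_ge0_le0//; last exact: ltW.
  by rewrite -expr2 sqr_ge0.
by rewrite addbF.
Qed.

(** For [m > 0] the factors of both roots are real. Having the same sign, they give the root of the
    quotient a positive factor. *)
Lemma turn_eq_root f g (m : R) : 0 < m -> ccont f -> ccont g ->
  f 1 = m%:C * f 0 -> g 1 = m%:C * g 0 ->
  (forall t, 0 <= t <= 1 -> f t != 0) -> (forall t, 0 <= t <= 1 -> g t != 0) ->
  turn f = turn g ->
  exists2 h, root_on 0 1 (fun t => f t * (g t)^*%C) h & 0 < h 1 * (h 0)^*%C.
Proof.
move=> m0 fc gc f1 g1 f0 g0.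
have [h hP] := root_on_exists ler01 fc f0; have [k kP] := root_on_exists ler01 gc g0.
rewrite (turnE hP) (turnE kP).
have i0 : 0 <= (0 : R) <= 1 by apply/andP; split; lra.
have i1 : 0 <= (1 : R) <= 1 by apply/andP; split; lra.
have re (f' h' : R -> R[i]) : f' 1 = m%:C * f' 0 -> root_on 0 1 f' h' ->
    Im (h' 1 * (h' 0)^*%C) = 0 /\ Re (h' 1 * (h' 0)^*%C) != 0.
  move=> e hP'; have [f'0 _] := rootc_neq0 (hP'.2 _ i0).
  have := rootcM (hP'.2 _ i1) (rootc_conj (hP'.2 _ i0)).
  have c0 : 0 < m%:C * (f' 0 * (f' 0)^*%C) by rewrite mulr_gt0 ?ltcR// mulcJ_gt0.
  rewrite e -mulrA -[_ * (_ * _)]mulr1 rootc_scale// => r1.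
  have := rootc_parallel (_ : rootc 1 1) r1; rewrite conjc1 mulr1; apply.
  by rewrite /rootc conjc1 expr1n mulr1 ltr01.
have [e1 r1] := re _ _ f1 hP; have [e2 r2] := re _ _ g1 kP.
rewrite e1 e2 !addr0 => s.
exists (fun t => h t * (k t)^*%C).
  split; first by apply: ccontM hP.1 _; apply: ccont_conj kP.1.
  by move=> t tab; apply: rootcM (hP.2 _ tab) (rootc_conj (kP.2 _ tab)).
have -> : h 1 * (k 1)^*%C * (h 0 * (k 0)^*%C)^*%C =
    (h 1 * (h 0)^*%C) * (k 1 * (k 0)^*%C)^*%C by rewrite !conjcM; ring.
move: (h 1 * _) (k 1 * _) e1 r1 e2 r2 s => [x x'] [y y'] /= -> x0 -> y0 s.
rewrite gt0_complex/= !(oppr0, mulr0, mul0r, addr0, subr0) eqxx/=.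
move: x0 y0 s; rewrite !neq_lt => /orP[] x0 /orP[] y0.
- by rewrite nmulr_rgt0.
- by rewrite y0 lt_gtF.
- by rewrite x0 lt_gtF.
- by rewrite mulr_gt0.
Qed.

(* |u + v|^2 + |u|^2 - |v|^2 = 2 Re ((u + v) u^* ) *)
Lemma dominant_term (u v : R[i]) : Re v ^+ 2 + Im v ^+ 2 < Re u ^+ 2 + Im u ^+ 2 ->
  0 < Re ((u + v) * u^*%C).
Proof.
case: u v => [a b] [c d] /= h.
have := sqr_ge0 (a + c); have := sqr_ge0 (b + d); rewrite !expr2 in h *; nra.
Qed.

(** A real linear map is [al] times [z] plus [be] times the conjugate of [z], and its determinant is
    [|al|^2 - |be|^2]. The sign of the determinant tells which term dominates; the other one is
    deformed away. *)
Lemma turn_real_linear f (m q1 q2 q3 q4 : R) : m != 0 -> ccont f ->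
  f 1 = m%:C * f 0 -> (forall t, 0 <= t <= 1 -> f t != 0) ->
  q1 * q4 - q2 * q3 != 0 ->
  turn (fun t => (q1 * Re (f t) + q2 * Im (f t)) +i* (q3 * Re (f t) + q4 * Im (f t)))
  = turn f (+) ((m < 0) && (q1 * q4 - q2 * q3 < 0)).
Proof.
move=> m0 fc f1 f0 D0.
pose al : R[i] := ((q1 + q4) / 2) +i* ((q3 - q2) / 2).
pose be : R[i] := ((q1 - q4) / 2) +i* ((q3 + q2) / 2).
have -> : (fun t => (q1 * Re (f t) + q2 * Im (f t)) +i* (q3 * Re (f t) + q4 * Im (f t)))
    = (fun t => al * f t + be * (f t)^*%C).
  apply: funext => t; case: (f t) => a b /=.
  by apply/eqP; rewrite eq_complex !(raddfD, cReM, cImM)/=; apply/andP; split; apply/eqP; field.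
have fJ1 : (f 1)^*%C = m%:C * (f 0)^*%C by rewrite f1 conjcM conjc_real.
have alc : ccont (fun t => al * f t) by apply: ccontM => //; exact: ccont_cst.
have bec : ccont (fun t => be * (f t)^*%C).
  by apply: ccontM; [exact: ccont_cst|exact: ccont_conj].
have sc : ccont (fun t => al * f t + be * (f t)^*%C).
  by apply: ccontD.
have nrm z w : Re (z * w) ^+ 2 + Im (z * w) ^+ 2 =
    (Re z ^+ 2 + Im z ^+ 2) * (Re w ^+ 2 + Im w ^+ 2).
  by rewrite cReM cImM; ring.
have D : Re al ^+ 2 + Im al ^+ 2 - (Re be ^+ 2 + Im be ^+ 2) = q1 * q4 - q2 * q3.
  by rewrite /=; field.
have s1 : al * f 1 + be * (f 1)^*%C = m%:C * (al * f 0 + be * (f 0)^*%C).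
  by rewrite fJ1 f1; ring.
have [Dn|Dp|] := ltgtP (q1 * q4 - q2 * q3) 0; last by move=> e; rewrite e eqxx in D0.
  have be0 : be != 0.
    rewrite complex_neq0; have := sqr_ge0 (Re al); have := sqr_ge0 (Im al); lra.
  have fJ0 t : 0 <= t <= 1 -> (f t)^*%C != 0 by move=> tab; rewrite conjc_eq0 f0.
  rewrite andbT -(turn_conj m0 fc f1 f0) -(turn_scale be0 (ccont_conj fc) fJ0).
  apply: (turn_deform m0) => //; first by rewrite fJ1; ring.
  move=> t tab; rewrite addrC; apply: dominant_term; rewrite !nrm cReJ cImJ sqrrN.
  rewrite ltr_pM2r ?subr_lt0; first lra.
  by have := f0 t tab; rewrite complex_neq0.
have al0 : al != 0.
  rewrite complex_neq0; have := sqr_ge0 (Re be); have := sqr_ge0 (Im be); lra.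
rewrite andbF addbF -(turn_scale al0 fc f0).
apply: (turn_deform m0) => //; first by rewrite f1; ring.
move=> t tab; apply: dominant_term; rewrite !nrm cReJ cImJ sqrrN.
rewrite ltr_pM2r; first lra.
by have := f0 t tab; rewrite complex_neq0.
Qed.

End Turn.

(** * The side of a point with respect to a closed curve *)

Section Side.
Variable R : realType.
Local Notation Re := (@complex.Re R).
Local Notation Im := (@complex.Im R).
Implicit Types (p v : 'rV[R]_3) (k j : 'I_3).

Lemma ord3P k j : [\/ j = k, j = k + 1 | j = k + 1 + 1].
Proof.
have : [|| j == k, j == k + 1 | j == k + 1 + 1].
  by case: k j => [[|[|[|]]]] // k3 [[|[|[|]]]].
by case/or3P => /eqP; [constructor 1|constructor 2|constructor 3].
Qed.

Lemma ord3_add k : k + 1 + 1 + 1 = k.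
Proof. by apply/val_inj; case: k => [[|[|[|]]]]. Qed.

Lemma row3_ext k p v : p 0 k = v 0 k -> p 0 (k + 1) = v 0 (k + 1) ->
  p 0 (k + 1 + 1) = v 0 (k + 1 + 1) -> p = v.
Proof. by move=> e0 e1 e2; apply/rowP => j; case: (ord3P k j) => ->. Qed.

(* When [p 0 k != 0], this is the direction of [v] seen along [p], in an affine
   chart; its orientation depends on the sign of [p 0 k]. *)
Definition trace k p v : R[i] :=
  (v 0 (k + 1) * p 0 k - p 0 (k + 1) * v 0 k) +i*
  (v 0 (k + 1 + 1) * p 0 k - p 0 (k + 1 + 1) * v 0 k).

Lemma trace_eq0 k p v : p 0 k != 0 -> trace k p v = 0 -> v = (v 0 k / p 0 k) *: p.
Proof.
move=> p0 [/eqP]; rewrite subr_eq0 => /eqP e1 /eqP; rewrite subr_eq0 => /eqP e2.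
apply: (row3_ext (k := k)); rewrite mxE; first by rewrite divfK.
  by apply: (mulIf p0); rewrite e1; field.
by apply: (mulIf p0); rewrite e2; field.
Qed.

Lemma traceZl k (c : R) p v : trace k (c *: p) v = c%:C * trace k p v.
Proof.
by apply/eqP; rewrite eq_complex /trace cReM cImM/= !mxE; apply/andP; split; apply/eqP; ring.
Qed.

Lemma traceZr k (c : R) p v : trace k p (c *: v) = c%:C * trace k p v.
Proof.
by apply/eqP; rewrite eq_complex /trace cReM cImM/= !mxE; apply/andP; split; apply/eqP; ring.
Qed.

Lemma ccont_trace (T : topologicalType) k (p v : T -> 'rV[R]_3) :
  (forall j, continuous (fun x => p x 0 j)) ->
  (forall j, continuous (fun x => v x 0 j)) ->
  ccont (fun x => trace k (p x) (v x)).
Proof.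
move=> pc vc; split => x; rewrite /trace /=; apply: cvgB; apply: cvgM;
  do [exact: pc|exact: vc].
Qed.

Variables (g : R -> 'rV[R]_3) (m : R).
Hypothesis gc : forall j, continuous (fun t => g t 0 j).
Hypothesis g0 : forall t, 0 <= t <= 1 -> g t != 0.
Hypothesis m0 : m != 0.
Hypothesis g1 : g 1 = m *: g 0.

(** The factor [c = 0] is included, so a vector off the curve is nonzero. *)
Definition off p := forall t, 0 <= t <= 1 -> forall c, c *: g t != p.

Lemma offZ c p : c != 0 -> off p -> off (c *: p).
Proof.
move=> c0 po t tab d; apply: contra_neq (po t tab (c^-1 * d)).
by rewrite -scalerA => ->; rewrite scalerA mulVf// scale1r.
Qed.

Lemma off_neq0 p : off p -> exists k, p 0 k != 0.
Proof.
move=> po; apply: contrapT => H.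
have /po/(_ 0) : 0 <= (0 : R) <= 1 by apply/andP; split; lra.
rewrite scale0r => /eqP; apply; apply/rowP => j; rewrite mxE.
by apply/eqP; rewrite eq_sym; apply/negPn/negP => pj; apply: H; exists j.
Qed.

Lemma trace_neq0 k p t : off p -> p 0 k != 0 -> 0 <= t <= 1 ->
  trace k p (g t) != 0.
Proof.
move=> po pk tab; apply/eqP => /(trace_eq0 pk) e.
have vk : g t 0 k != 0.
  apply: contraNneq (g0 tab) => vk; rewrite e vk mul0r scale0r; exact: eqxx.
have := po t tab (p 0 k / g t 0 k); rewrite e scalerA mxE.
by rewrite (_ : _ * _ = 1) ?scale1r ?eqxx//; field; rewrite vk pk.
Qed.

Let cst_cont (p : 'rV[R]_3) j : continuous (fun _ : R => p 0 j).
Proof. by move=> x; exact: cvg_cst. Qed.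

Let trace1 k p : trace k p (g 1) = m%:C * trace k p (g 0).
Proof. by rewrite g1 traceZr. Qed.

(* For [m < 0] this is odd in [p] and separates antipodes; for [m > 0] it is even,
   and it is the parity of the winding number of [g] around the axis [p]. *)
Definition side_at k p := turn (fun t => trace k p (g t)) (+) ((m < 0) && (p 0 k < 0)).

(** Passing to the next chart applies to the trace a real linear map of determinant
    [p 0 (k + 1) / p 0 k]. Its sign affects [turn] only if [m < 0], and the correction in [side_at]
    absorbs it. *)
Lemma side_at_next k p : off p -> p 0 k != 0 -> p 0 (k + 1) != 0 ->
  side_at (k + 1) p = side_at k p.
Proof.
move=> po pk pk1; rewrite /side_at.
have -> : (fun t => trace (k + 1) p (g t)) = fun t =>
    (- (p 0 (k + 1 + 1) / p 0 k) * Re (trace k p (g t)) +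
     p 0 (k + 1) / p 0 k * Im (trace k p (g t))) +i*
    (- 1 * Re (trace k p (g t)) + 0 * Im (trace k p (g t))).
  apply: funext => t; rewrite /trace ord3_add/=.
  by apply/eqP; rewrite eq_complex/=; apply/andP; split; apply/eqP; field.
rewrite (turn_real_linear m0); first last.
- by rewrite mulr0 mulrN1 sub0r opprK mulf_neq0// invr_eq0.
- by move=> t; exact: trace_neq0.
- exact: trace1.
- exact: ccont_trace.
rewrite mulr0 mulrN1 sub0r opprK.
have -> : (p 0 (k + 1) / p 0 k < 0) = (p 0 k < 0) (+) (p 0 (k + 1) < 0).
  move: pk pk1; rewrite !neq_lt => /orP[] x0 /orP[] y0; rewrite ?x0 ?y0 /=.
  - by rewrite lt_gtF// nmulr_lgt0 ?invr_lt0.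
  - by rewrite (lt_gtF y0) pmulr_rlt0 ?invr_lt0.
  - by rewrite (lt_gtF x0)/= nmulr_rlt0 ?invr_gt0.
  - by rewrite (lt_gtF x0) (lt_gtF y0) lt_gtF// mulr_gt0 ?invr_gt0.
by case: (turn _); case: (m < 0); case: (p 0 k < 0); case: (_ < 0).
Qed.

Lemma side_at_indep j k p : off p -> p 0 k != 0 -> p 0 j != 0 ->
  side_at j p = side_at k p.
Proof.
move=> po pk pj; have [->//|e|e] := ord3P k j.
  by move: pj; rewrite e; exact: side_at_next.
have e' : k = j + 1 by rewrite e ord3_add.
by move: pk; rewrite e' => pk; rewrite side_at_next.
Qed.

Definition side p := if [pick k | p 0 k != 0] is Some k then side_at k p else false.

Lemma sideE k p : off p -> p 0 k != 0 -> side p = side_at k p.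
Proof.
move=> po pk; rewrite /side; case: pickP => [j pj|/(_ k)]; last by rewrite pk.
exact: side_at_indep.
Qed.

Lemma sideZ c p : c != 0 -> off p -> side (c *: p) = side p (+) ((m < 0) && (c < 0)).
Proof.
move=> c0 po; have [k pk] := off_neq0 po.
rewrite (sideE po pk) (@sideE k); [|exact: offZ|by rewrite mxE mulf_neq0].
rewrite /side_at mxE.
have -> : turn (fun t => trace k (c *: p) (g t)) = turn (fun t => trace k p (g t)).
  rewrite -(@turn_scale _ (fun t => trace k p (g t)) c%:C).
  - by congr turn; apply: funext => t; rewrite traceZl.
  - by rewrite -(rmorph0 (real_complex R)) (inj_eq (@complexI R)).
  - exact: ccont_trace.
  - by move=> t; exact: trace_neq0.
have -> : (c * p 0 k < 0) = (c < 0) (+) (p 0 k < 0).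
  move: pk c0; rewrite !neq_lt => /orP[] x0 /orP[] y0; rewrite ?x0 ?y0 /=.
  - by rewrite lt_gtF// nmulr_rgt0.
  - by rewrite (lt_gtF y0) pmulr_rlt0.
  - by rewrite (lt_gtF x0) nmulr_rlt0.
  - by rewrite (lt_gtF x0) (lt_gtF y0) lt_gtF// mulr_gt0.
by case: (turn _); case: (m < 0); case: (p 0 k < 0); case: (_ < 0).
Qed.

(** By [near_segment], the directions seen along nearby vectors stay within a right angle of the
    original ones for all [t] at once, so [turn_deform] applies. Being nonzero, they also keep the
    nearby vectors off the curve. *)
Lemma side_near (p : R -> 'rV[R]_3) u :
  (forall j, continuous (fun x => p x 0 j)) -> off (p u) ->
  \forall u' \near u, side (p u') = side (p u).
Proof.
move=> pc po; have [k pk] := off_neq0 po.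
have nz : \forall u' \near u, (p u' 0 k < 0) = (p u 0 k < 0) /\ p u' 0 k != 0.
  move: pk; rewrite neq_lt => /orP[] h.
    have H : \forall u' \near u, p u' 0 k < 0 by exact: (cvgr_lt _ (pc k u)).
    apply: filterS H => u' h'.
    by rewrite h h' neq_lt h'.
  have H : \forall u' \near u, 0 < p u' 0 k by exact: (cvgr_gt _ (pc k u)).
  apply: filterS H => u' h'.
  by rewrite (lt_gtF h) (lt_gtF h') neq_lt h' orbT.
have dir : \forall u' \near u, forall t, 0 <= t <= 1 ->
    0 < Re (trace k (p u') (g t) * (trace k (p u) (g t))^*%C).
  apply: (near_segment (Q := fun t u' =>
    Re (trace k (p u') (g t) * (trace k (p u) (g t))^*%C))).
    suff [] : ccont (fun z : R * R =>
        trace k (p z.2) (g z.1) * (trace k (p u) (g z.1))^*%C) by [].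
    have gc1 j : continuous (fun z : R * R => g z.1 0 j).
      move=> z; apply: (@continuous_comp _ _ _ (@fst R R) (fun t => g t 0 j)).
        exact: cvg_fst.
      exact: gc.
    apply: ccontM; [|apply: ccont_conj]; apply: ccont_trace => // j.
    - move=> z; apply: (@continuous_comp _ _ _ (@snd R R) (fun t => p t 0 j)).
        exact: cvg_snd.
      exact: pc.
    - by move=> z; exact: cvg_cst.
  move=> t tab.
  by have := mulcJ_gt0 (trace_neq0 po pk tab); rewrite gt0_complex => /andP[].
apply: filterS2 nz dir => u' [s nz'] dir.
have po' : off (p u').
  move=> t tab c; apply: contraTneq (dir t tab) => <-.
  rewrite traceZl (_ : trace k (g t) (g t) = 0) ?mulr0 ?mul0r ?ltxx//.
  by apply/eqP; rewrite eq_complex /trace/= ![g t 0 _ * g t 0 k]mulrC !subrr eqxx.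
rewrite (sideE po pk) (sideE po' nz') /side_at s; congr (_ (+) _).
by apply: (turn_deform m0) => //; exact: ccont_trace.
Qed.

Lemma side_const (p : R -> 'rV[R]_3) a b :
  (forall j, continuous (fun x => p x 0 j)) ->
  (forall u, a <= u <= b -> off (p u)) ->
  forall s t, a <= s <= b -> a <= t <= b -> side (p s) = side (p t).
Proof.
move=> pc po; apply: (@const_bool _ (fun u => side (p u))) => u uab.
exact: side_near (po u uab).
Qed.

End Side.

(** * The projective plane *)

Section Quotient.
Local Open Scope quotient_scope.

Lemma sum_cont (R : realType) (T : topologicalType) n (F : 'I_n -> T -> R) :
  (forall i, continuous (F i)) -> continuous (fun x => \sum_i F i x).
Proof. by move=> Fc; apply: continuous_big => //; exact: add_continuous. Qed.

Lemma mul_cont (R : realType) (T : topologicalType) (f g : T -> R) :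
  continuous f -> continuous g -> continuous (fun x => f x * g x).
Proof. by move=> fc gc x; exact: (cvgM (fc x) (gc x)). Qed.

Lemma comp_cont (S T U : topologicalType) (f : S -> T) (g : T -> U) :
  continuous f -> continuous g -> continuous (fun x => g (f x)).
Proof. by move=> fc gc x; exact: (continuous_comp (fc x) (gc (f x))). Qed.

Section ProjectivePlane.
Variable R : realType.
Local Notation P2 := (projective_plane R).
Implicit Types (x y : P2) (v w : 'rV[R]_3).

Definition rep x : 'rV[R]_3 := set_val (repr x).

Lemma rep_neq0 x : rep x != 0.
Proof. exact: (set_valP (repr x)). Qed.

Lemma rep_inj x y c : rep x = c *: rep y -> x = y.
Proof.
move=> e.
have c0 : c != 0.
  by apply: contraNneq (rep_neq0 x) => c0; rewrite e c0 scale0r.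
rewrite -[x]reprK -[y]reprK; apply/eqmodP => /=.
by apply/asboolP; exists c.
Qed.

Definition dot v w : R := \sum_k v 0 k * w 0 k.

Lemma dot_gt0 v : v != 0 -> 0 < dot v v.
Proof.
move=> v0; rewrite lt0r sumr_ge0 ?andbT => [|k _]; last by rewrite -expr2 sqr_ge0.
apply: contraNneq v0 => e; apply/eqP/rowP => k; rewrite mxE.
have sq j : true -> 0 <= v 0 j * v 0 j by rewrite -expr2 sqr_ge0.
by apply/eqP; rewrite -sqrf_eq0 expr2; exact/eqP/(psumr_eq0P sq e).
Qed.

(* Entries of the orthogonal projection onto the line [x] of R^3. *)
Definition proj x i j : R := rep x 0 i * rep x 0 j / dot (rep x) (rep x).

(** The entries are homogeneous of degree 0, hence descend to the quotient. They replace the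
    arbitrary choice [rep] wherever continuity matters. *)
Lemma proj_continuous i j : continuous (fun x => proj x i j).
Proof.
pose q (u : @nonzero_vectors R) := set_val u 0 i * set_val u 0 j /
  dot (set_val u) (set_val u).
have sc k : continuous (fun u : @nonzero_vectors R => set_val u 0 k).
  move=> u; apply: (continuous_comp (f := set_val) (g := fun v : 'rV[R]_3 => v 0 k)).
    exact: initial_continuous.
  exact: coord_continuous.
apply: (@repr_comp_continuous _ _ _ q).
  have mc k l : continuous (fun u : @nonzero_vectors R => set_val u 0 k * set_val u 0 l).
    by move=> u; exact: (cvgM (sc k u) (sc l u)).
  have dc : continuous (fun u : @nonzero_vectors R => dot (set_val u) (set_val u)).
    by move=> u; apply: sum_cont => k; exact: mc.
  have d0 (u : @nonzero_vectors R) : dot (set_val u) (set_val u) != 0.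
    by rewrite gt_eqF// dot_gt0// (set_valP u).
  move=> u; exact: (cvgM (mc i j u) (cvgV (d0 u) (dc u))).
move=> u v /eqP/eqmodP/= /asboolP [c c0 e]; apply/eqP; rewrite /q e /dot.
have -> : \sum_k (c *: set_val v) 0 k * (c *: set_val v) 0 k =
   c ^+ 2 * dot (set_val v) (set_val v).
  by rewrite mulr_sumr; apply: eq_bigr => k _; rewrite !mxE; ring.
have := dot_gt0 (set_valP v); rewrite /dot !mxE => d0; field.
by rewrite c0 gt_eqF.
Qed.

Definition apply_proj v x : 'rV[R]_3 := \row_j \sum_i v 0 i * proj x i j.

Lemma apply_projE v x :
  apply_proj v x = (dot v (rep x) / dot (rep x) (rep x)) *: rep x.
Proof.
apply/rowP => j; rewrite !mxE /dot !mulr_suml; apply: eq_bigr => i _.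
by rewrite /proj; ring.
Qed.

(** The sum is the trace of the product of two projections, which is the squared cosine of the angle
    between the lines. *)
Lemma overlap_gt0 x y : 0 < \sum_i \sum_j proj x i j * proj y i j -> dot (rep x) (rep y) != 0.
Proof.
move=> h; apply: contraTneq h => e.
have dx := dot_gt0 (rep_neq0 x); have dy := dot_gt0 (rep_neq0 y).
suff -> : \sum_i \sum_j proj x i j * proj y i j = dot (rep x) (rep y) *
   (dot (rep x) (rep y) * (dot (rep x) (rep x) * dot (rep y) (rep y))^-1).
  by rewrite e mul0r ltxx.
rewrite /proj; move: (dot (rep x) (rep x)) (dot (rep y) (rep y)) dx dy => c d dx dy.
rewrite {e}/dot mulr_suml; apply: eq_bigr => i _.
rewrite mulr_suml mulr_sumr; apply: eq_bigr => j _.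
by field; rewrite !gt_eqF.
Qed.

Lemma overlap_refl x : 0 < \sum_i \sum_j proj x i j * proj x i j.
Proof.
have [k xk] : exists k, rep x 0 k != 0.
  apply: contrapT => H; have /eqP := rep_neq0 x; apply; apply/rowP => j.
  by rewrite mxE; apply/eqP/negPn/negP => xj; apply: H; exists j.
have sq i j : 0 <= proj x i j * proj x i j by rewrite -expr2 sqr_ge0.
rewrite (bigD1 k)//= ltr_wpDr ?sumr_ge0// => [i _|]; first exact: sumr_ge0.
rewrite (bigD1 k)//= ltr_wpDr ?sumr_ge0//.
have d0 := dot_gt0 (rep_neq0 x).
by rewrite -expr2 exprn_even_gt0//= /proj !mulf_neq0// invr_eq0 gt_eqF.
Qed.

Lemma lift_path (f : R -> P2) : continuous f ->
  exists2 g : R -> 'rV[R]_3, forall j, continuous (fun t => g t 0 j) &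
  forall t, 0 <= t <= 1 -> exists2 c, c != 0 & g t = c *: rep (f t).
Proof.
move=> fc.
(* The lift is the image of a fixed vector under successive projections onto
   close lines. *)
pose Q t d := \sum_i \sum_j proj (f (t + d)) i j * proj (f t) i j.
have [||e e0 He] := @near_segment _ Q 0 1 0.
- apply: sum_cont => i; apply: sum_cont => j; apply: mul_cont.
    have pc : continuous (fun z : R * R => f (z.1 + z.2)).
      have ac : continuous (fun z : R * R => z.1 + z.2) by exact: add_continuous.
      exact: (comp_cont ac fc).
    exact: (comp_cont pc (@proj_continuous i j)).
  have pc : continuous (fun z : R * R => f z.1).
    have fstc : continuous (@fst R R) by move=> z; exact: cvg_fst.
    exact: (comp_cont fstc fc).
  exact: (comp_cont pc (@proj_continuous i j)).
- by move=> t _; rewrite /Q addr0 overlap_refl.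
have [n nP] : exists n, n.+1%:R^-1 < e.
  exists (Num.bound e^-1); rewrite invf_plt ?posrE//.
  by rewrite (lt_le_trans (archi_boundP _)) ?ler_nat// invr_ge0 ltW.
pose c : R := n.+1%:R^-1.
have c0 : 0 <= c by rewrite invr_ge0.
pose m (k : nat) t := Order.min t (c * k%:R).
have mab k t : 0 <= t <= 1 -> 0 <= m k t <= 1.
  move=> /andP[at' tb]; rewrite le_min at' ge_min tb !andbT/=.
  by rewrite mulr_ge0.
pose G := fix G (k : nat) t :=
  if k is k'.+1 then apply_proj (G k' t) (f (m k t)) else rep (f 0).
exists (G n.+1) => [|t tab].
  elim: n.+1 => [|k IH] j; first by move=> t; exact: cvg_cst.
  under eq_fun do rewrite mxE; apply: sum_cont => i; apply: mul_cont; first exact: IH.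
  have mc : continuous (m k.+1) by exact: min_cont.
  exact: (comp_cont (comp_cont mc fc) (@proj_continuous i j)).
have H k : exists2 d, d != 0 & G k t = d *: rep (f (m k t)).
  elim: k => [|k [d d0 IH]] /=.
    exists 1; rewrite ?oner_eq0// scale1r; congr (rep (f _)).
    by rewrite /m mulr0 min_r//; case/andP: tab.
  rewrite apply_projE; eexists; last by [].
  rewrite IH mulf_neq0//; last by rewrite invr_eq0 gt_eqF// dot_gt0// rep_neq0.
  have -> : dot (d *: rep (f (m k t))) (rep (f (m k.+1 t))) =
      d * dot (rep (f (m k t))) (rep (f (m k.+1 t))).
    by rewrite /dot mulr_sumr; apply: eq_bigr => i _; rewrite mxE mulrA.
  rewrite mulf_neq0// /dot; under eq_bigr do rewrite mulrC; apply: overlap_gt0.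
  have := He (m k.+1 t - m k t) _ (m k t) (mab k t tab).
  rewrite /Q subrKC; apply; rewrite /= sub0r normrN.
  apply: le_lt_trans nP; rewrite -/c.
  have ck : c * k.+1%:R = c * k%:R + c by rewrite -natr1; ring.
  rewrite /m ck; move: (c * k%:R) c0 => x; move: (c) => y y0; rewrite ler_norml.
  by have [?|?] := leP t x; have [?|?] := leP t (x + y); apply/andP; split; lra.
have [d d0 ->] := H n.+1; exists d => //; congr (_ *: rep (f _)).
by rewrite /m min_l// /c mulVf ?pnatr_eq0//; case/andP: tab.
Qed.

End ProjectivePlane.

End Quotient.

(** * Chords of an injective map of a square *)

Section Planar.
Variable R : realType.
Local Notation Re := (@complex.Re R).
Local Notation Im := (@complex.Im R).
Implicit Types (a b t u : R).

(** If [f] has positive real part at [- al] and [al], the root is close to the real axis there, and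
    this tells whether it is on the same side of the imaginary axis both times. *)
Definition ends_sign r al (f : R -> R[i]) :=
  `[< exists K, root_on (- r) r f K /\ 0 < Re (K (- al)) * Re (K al) >].

Lemma ends_signE r al f K : - r <= - al <= r -> - r <= al <= r ->
  root_on (- r) r f K -> ends_sign r al f = (0 < Re (K (- al)) * Re (K al)).
Proof.
move=> i0 i1 KP; apply/asboolP/idP => [[K' [KP']]|h0]; last by exists K.
by rewrite -(root_on_Re_sign KP' KP i0 i1).
Qed.

(** [w] turns [z] by less than 45 degrees, and [z] is less than 45 degrees away from the real
    axis. *)
Lemma Re_mul_dominant (z w : R[i]) : Im z ^+ 2 < Re z ^+ 2 -> Im w ^+ 2 < Re w ^+ 2 ->
  0 < Re w -> 0 < Re (z * w) * Re z.
Proof.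
case: z w => [x y] [u v] /= yx vu u0.
have yv : (y * v) ^+ 2 < (x * u) ^+ 2.
  rewrite !exprMn (le_lt_trans (ler_wpM2l (sqr_ge0 _) (ltW vu)))//.
  by rewrite ltr_pM2r ?exprn_gt0.
have : `|y * v| < `|x * u| by rewrite -ltr_sqr ?nnegrE// !real_normK ?num_real.
have x0 : x != 0 by apply: contraTneq yx => ->; rewrite expr0n/= -leNgt sqr_ge0.
have x2 : 0 < x ^+ 2 by rewrite exprn_even_gt0.
case: (ltgtP x 0) => xs; last by rewrite xs eqxx in x0.
  have xu : x * u < 0 by rewrite nmulr_rlt0.
  rewrite (ltr0_norm xu) ltr_norml => /andP[h1 h2].
  by rewrite nmulr_lgt0//; lra.
rewrite (gtr0_norm (mulr_gt0 xs u0)) ltr_norml => /andP[h1 h2].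
by rewrite mulr_gt0//; lra.
Qed.

Variables (G : R -> R -> R[i]) (r : R).
Hypothesis Gc : ccont (fun z : R * R => G z.1 z.2).
Hypothesis G_inj : forall a b a' b', - r <= a <= r -> - r <= b <= r ->
  - r <= a' <= r -> - r <= b' <= r -> G a b = G a' b' -> a = a' /\ b = b'.

(* Interpolates between [G a 0 - G 0 b] and a function odd in [(a, b)]; both
   arguments of [G] differ by [(a, - b)] throughout. *)
Definition chord u a b : R[i] :=
  G (a * (1 - u / 2)) (- (u * b / 2)) - G (- (u * a / 2)) (b * (1 - u / 2)).

Definition chord_ratio b u a := chord u a b * (chord u a (- b))^*%C.

Lemma chord_neq0 u a b : 0 <= u <= 1 -> - r <= a <= r -> - r <= b <= r ->
  (a != 0) || (b != 0) -> chord u a b != 0.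
Proof.
move=> /andP[u0 u1] /andP[a1 a2] /andP[b1 b2] ab.
rewrite subr_eq0; apply/eqP => e; have [||||e1 e2] := G_inj _ _ _ _ e.
- by apply/andP; split; nra.
- by apply/andP; split; nra.
- by apply/andP; split; nra.
- by apply/andP; split; nra.
have a0 : a = 0 by lra.
have b0 : b = 0 by lra.
by move: ab; rewrite a0 b0 eqxx.
Qed.

Lemma ccont_chord (T : topologicalType) (u a b : T -> R) :
  continuous u -> continuous a -> continuous b ->
  ccont (fun x => chord (u x) (a x) (b x)).
Proof.
move=> uc ac bc.
have cc e : continuous (fun _ : T => e : R) by move=> x; exact: cvg_cst.
have cG (p q : T -> R) : continuous p -> continuous q -> ccont (fun x => G (p x) (q x)).
  move=> pc qc.
  have h : continuous (fun x => (p x, q x)) by move=> x; exact: (cvg_pair (pc x) (qc x)).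
  exact: (ccont_comp h Gc).
have lin (c : T -> R) (e1 e2 : R) : continuous c ->
    continuous (fun x => e1 * c x + e2 * (u x * c x)).
  by move=> cc' x; exact: (cvgD (cvgM (cc e1 x) (cc' x)) (cvgM (cc e2 x) (cvgM (uc x) (cc' x)))).
have cE (p q : T -> R) : p =1 q -> continuous q -> continuous p by move=> /funext->.
apply: ccontD; [|under eq_fun do rewrite -mulN1r; apply: ccontM; first exact: ccont_cst].
  by apply: cG; [apply: cE (lin a 1 (- 2^-1) ac)|apply: cE (lin b 0 (- 2^-1) bc)];
    move=> x; field.
by apply: cG; [apply: cE (lin a 0 (- 2^-1) ac)|apply: cE (lin b 1 (- 2^-1) bc)];
  move=> x; field.
Qed.

Lemma ccont_chord_ratio (T : topologicalType) (b u a : T -> R) :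
  continuous b -> continuous u -> continuous a ->
  ccont (fun x => chord_ratio (b x) (u x) (a x)).
Proof.
move=> bc uc ac; apply: ccontM; first exact: ccont_chord.
apply: ccont_conj; apply: ccont_chord => // x; exact: (cvgN (bc x)).
Qed.

Lemma chord_ratio_neq0 b u a : 0 < b <= r -> 0 <= u <= 1 -> - r <= a <= r ->
  chord_ratio b u a != 0.
Proof.
move=> /andP[b0 br] u01 ar.
by rewrite mulf_neq0 ?conjc_eq0 ?chord_neq0// ?oppr_eq0 ?(gt_eqF b0) ?orbT//;
  apply/andP; split; lra.
Qed.

(** At [u = 1] the chord is odd, so [a] and [- a] give conjugate ratios, and the ratio at [0] is
    negative. A root [K] is thus imaginary at [0]; comparing it with the conjugate of its reflection
    in [a] yields real parts of opposite signs at the two ends. *)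
Lemma ends_sign_odd al b : 0 < al <= r -> 0 < b <= r ->
  0 < Re (chord_ratio b 1 al) -> 0 < Re (chord_ratio b 1 (- al)) ->
  ends_sign r al (chord_ratio b 1) = false.
Proof.
move=> /andP[al0 alr] /andP[b0 br] pos neg.
have sym a : chord_ratio b 1 (- a) = (chord_ratio b 1 a)^*%C.
  rewrite /chord_ratio conjcM conjcK mulrC.
  have oddc c d : chord 1 (- c) (- d) = - chord 1 c d.
    by rewrite /chord opprB; congr (G _ _ - G _ _); field.
  by rewrite oddc -[b in chord _ (- a) b]opprK oddc raddfN mulrNN.
have qc : ccont (chord_ratio b 1).
  apply: (@ccont_chord_ratio R (fun=> b) (fun=> 1) (fun x => x)) => x; do ?exact: cvg_cst.
  exact: cvg_id.
have r0 : 0 <= r by lra.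
have q0 a : - r <= a <= r -> chord_ratio b 1 a != 0.
  by apply: chord_ratio_neq0; apply/andP; split => //; lra.
have [|K KP] := @root_on_exists _ (- r) r _ _ qc q0; first by lra.
have ia : - r <= al <= r by apply/andP; split; lra.
have ina : - r <= - al <= r by apply/andP; split; lra.
have i0 : - r <= 0 <= r by apply/andP; split; lra.
rewrite (ends_signE ina ia KP).
have KP' : root_on (- r) r (chord_ratio b 1) (fun a => (K (- a))^*%C).
  split; first by apply: ccont_conj; apply: (ccont_comp _ KP.1) => x; exact: opp_continuous.
  move=> a ar; rewrite -[a in chord_ratio _ _ a]opprK sym; apply: rootc_conj.
  by apply: KP.2; move: ar => /andP[? ?]; apply/andP; split; lra.
have := root_on_unique KP KP' i0 ia; rewrite oppr0.
have K0 : Re ((K 0)^*%C * (K 0)^*%C) < 0.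
  have : Re (chord_ratio b 1 0) < 0 /\ Im (chord_ratio b 1 0) = 0.
    have c0 : chord 1 0 b != 0.
      by apply: chord_neq0; rewrite ?(gt_eqF b0) ?orbT//; apply/andP; split; lra.
    have -> : chord_ratio b 1 0 = - (chord 1 0 b * (chord 1 0 b)^*%C).
      rewrite /chord_ratio -mulrN -raddfN; congr (_ * _^*%C).
      by rewrite /chord opprB; congr (G _ _ - G _ _); field.
    have := mulcJ_gt0 c0; rewrite gt0_complex; case: (_ * _) => x y /= /andP[/eqP-> ?].
    by rewrite oppr_lt0 oppr0.
  have := KP.2 0 i0; rewrite /rootc; move: (K 0) (chord_ratio b 1 0) => [x y] [c d] /=.
  by rewrite gt0_complex !(cReM, cImM, expr2)/= => /andP[_ h] [c0 d0]; rewrite d0 in h; nra.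
rewrite nmulr_rgt0// => h.
have := rootc_Re pos (KP.2 _ ia); have := rootc_Re neg (KP.2 _ ina).
move: h; move: (K al) (K (- al)) => [x y] [x' y']; rewrite cReM/= => h h1 h2.
apply/negbTE; rewrite -leNgt leNgt; apply/negP => xx.
have : (y' * y) ^+ 2 < (x' * x) ^+ 2.
  rewrite !exprMn (le_lt_trans (ler_wpM2r (sqr_ge0 _) (ltW h1)))//.
  rewrite ltr_pM2l// exprn_even_gt0//=; apply: contraTneq xx => ->.
  by rewrite mul0r ltxx.
rewrite -ltr_sqrt; first by nra.
by rewrite exprn_gt0.
Qed.

(** While [u] varies, the ratio stays in the right half-plane at both ends, so the real parts of its
    root cannot vanish there and [ends_sign] is locally constant. Its value at [u = 1] comes from
    [ends_sign_odd]. *)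
Lemma chord_ratio_ends al b : 0 < al <= r -> 0 < b <= r ->
  (forall u, 0 <= u <= 1 ->
     0 < Re (chord_ratio b u al) /\ 0 < Re (chord_ratio b u (- al))) ->
  forall K, root_on (- r) r (chord_ratio b 0) K -> Re (K (- al)) * Re (K al) < 0.
Proof.
move=> alr br pos K KP.
have [al0 alr'] := andP alr.
have ia : - r <= al <= r by apply/andP; split; lra.
have ina : - r <= - al <= r by apply/andP; split; lra.
have i0 : 0 <= (0 : R) <= 1 by apply/andP; split; lra.
have i1 : 0 <= (1 : R) <= 1 by apply/andP; split; lra.
have qc u : ccont (chord_ratio b u).
  apply: (@ccont_chord_ratio R (fun=> b) (fun=> u) (fun x => x)) => x; do ?exact: cvg_cst.
  exact: cvg_id.
have : ends_sign r al (chord_ratio b 0) = false.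
  rewrite -(ends_sign_odd alr br (pos _ i1).1 (pos _ i1).2).
  apply: (@const_bool _ (fun u => ends_sign r al (chord_ratio b u)) 0 1) => // u u01.
  have q0 a : - r <= a <= r -> chord_ratio b u a != 0 by exact: chord_ratio_neq0.
  have [|L LP] := @root_on_exists _ (- r) r _ _ (qc u) q0; first by lra.
  have : \forall u' \near u, forall a, - r <= a <= r ->
      0 < Re (chord_ratio b u' a * (chord_ratio b u a)^*%C).
    apply: (near_segment (Q := fun a u' =>
      Re (chord_ratio b u' a * (chord_ratio b u a)^*%C))).
      suff [] : ccont (fun z : R * R =>
          chord_ratio b z.2 z.1 * (chord_ratio b u z.1)^*%C) by [].
      have fc : continuous (@fst R R) by move=> z; exact: cvg_fst.
      have sc : continuous (@snd R R) by move=> z; exact: cvg_snd.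
      apply: ccontM; last by apply: ccont_conj; exact: (ccont_comp fc (qc u)).
      apply: (@ccont_chord_ratio _ (fun=> b) snd fst) => // z; exact: cvg_cst.
    by move=> a ar; have := mulcJ_gt0 (q0 a ar); rewrite gt0_complex => /andP[].
  apply: filterS => u' near_u.
  rewrite (ends_signE ina ia LP) (ends_signE ina ia (root_on_deform (qc u) (qc u') near_u LP)).
  have dom a : - r <= a <= r -> 0 < Re (chord_ratio b u a) -> 0 < Re (L a *
      sqrt_dir (chord_ratio b u' a * (chord_ratio b u a)^*%C)) * Re (L a).
    move=> ar pa; have h := near_u a ar.
    apply: Re_mul_dominant; [exact: rootc_Re pa (LP.2 _ ar)| |exact: Re_sqrt_dir].
    exact: rootc_Re h (rootc_sqrt_dir h).
  have := dom _ ia (pos u u01).1; have := dom _ ina (pos u u01).2.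
  move: (Re (L al)) (Re (L (- al))) (Re (L al * _)) (Re (L (- al) * _)).
  move=> x y x' y' yy xx; apply/idP/idP => h.
    rewrite -(pmulr_rgt0 _ h); have := mulr_gt0 yy xx.
    by congr (_ < _); ring.
  rewrite -(pmulr_lgt0 _ h); have := mulr_gt0 yy xx.
  by congr (_ < _); ring.
rewrite (ends_signE ina ia KP) => /negbT; rewrite -leNgt lt_neqAle => ->.
rewrite andbT; have := rootc_Re (pos _ i0).1 (KP.2 _ ia).
have := rootc_Re (pos _ i0).2 (KP.2 _ ina); move: (Re (K al)) (Re (K (- al))) => x y h1 h2.
rewrite mulf_neq0//; [apply: contraTneq h1|apply: contraTneq h2] => ->;
  by rewrite expr0n/= -leNgt sqr_ge0.
Qed.

End Planar.

(** * Lifts of closed curves *)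

Section Lift.
Variable R : realType.
Local Notation P2 := (projective_plane R).
Local Notation Re := (@complex.Re R).
Local Notation Im := (@complex.Im R).
Implicit Types (L M : set P2) (f : R -> P2) (g : R -> 'rV[R]_3) (m : R).

(** [f] parametrizes the curve on [[0, 1]], [g] lifts it to nonzero vectors, and [m] is the factor
    gained after one turn; its sign tells whether the lift closes up or ends on the antipodal
    side. *)
Record closed_lift L f g m : Prop := ClosedLift {
  cl_cont : continuous f;
  cl_loop : f 0 = f 1;
  cl_inj : {in `[0, 1[ &, injective f};
  cl_im : L = f @` `[0, 1];
  cl_gcont : forall j, continuous (fun t => g t 0 j);
  cl_rep : forall t, 0 <= t <= 1 -> exists2 c, c != 0 & g t = c *: rep (f t);
  cl_m0 : m != 0;
  cl_g1 : g 1 = m *: g 0 }.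

Lemma closed_curve_lift L : simple_closed_curve R L ->
  exists f g m, closed_lift L f g m.
Proof.
move=> [f [fc f01 finj fL]].
have fc' := within_clamp ler01 fc.
have [g gc grep] := lift_path fc'.
have fE t : 0 <= t <= 1 -> f (clamp 0 1 t) = f t by move=> /clamp_id->.
have i0 : 0 <= (0 : R) <= 1 by apply/andP; split; lra.
have i1 : 0 <= (1 : R) <= 1 by apply/andP; split; lra.
have [c0 c00 g0] := grep _ i0; have [c1 c10 g1] := grep _ i1.
rewrite !fE// -?f01 in g0 g1.
exists (fun t => f (clamp 0 1 t)), g, (c1 / c0); split => //.
- by rewrite !fE.
- move=> s t; rewrite !in_itv/= => /andP[s0 s1] /andP[t0 t1].
  rewrite !fE ?s0 ?t0 ?(ltW s1) ?(ltW t1)// => /finj.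
  by apply; rewrite in_itv/= ?s0 ?t0.
- rewrite fL; apply/seteqP; split => x [t] /=; rewrite in_itv/= => tab <-;
    by exists t; rewrite /= ?in_itv/= ?fE.
- by rewrite mulf_neq0// invr_eq0.
- by rewrite g1 g0 scalerA divfK.
Qed.

Section Side.
Variables (L : set P2) (f : R -> P2) (g : R -> 'rV[R]_3) (m : R).
Hypothesis cl : closed_lift L f g m.

Lemma cl_neq0 t : 0 <= t <= 1 -> g t != 0.
Proof.
by move=> /(cl_rep cl)[c c0 ->]; rewrite scaler_eq0 negb_or c0 rep_neq0.
Qed.

Lemma cl_off y : ~ L y -> off g (rep y).
Proof.
move=> Ly t tab c; apply/eqP => e; have [d d0 gE] := cl_rep cl tab.
apply: Ly; rewrite (cl_im cl); exists t; first by rewrite /= in_itv.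
by apply/esym/(@rep_inj _ _ _ (c * d)); rewrite -scalerA -gE.
Qed.

Lemma cl_sideZ y c : c != 0 -> ~ L y ->
  side g m (c *: rep y) = side g m (rep y) (+) ((m < 0) && (c < 0)).
Proof.
move=> c0 /cl_off; apply: sideZ => //; [exact: cl_gcont cl|exact: cl_neq0|
  exact: cl_m0 cl|exact: cl_g1 cl].
Qed.

Lemma cl_side_arc M f' g' m' a b : closed_lift M f' g' m' -> 0 <= a -> b <= 1 ->
  (forall u, a <= u <= b -> ~ L (f' u)) ->
  forall s t, a <= s <= b -> a <= t <= b -> side g m (g' s) = side g m (g' t).
Proof.
move=> cl' a0 b1 Lf; apply: side_const; [exact: cl_gcont cl|exact: cl_neq0|
  exact: cl_m0 cl|exact: cl_g1 cl|exact: cl_gcont cl'|].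
move=> u uab; have [|c c0 ->] := cl_rep cl' (_ : 0 <= u <= 1).
  by move: uab => /andP[? ?]; apply/andP; split; lra.
by apply: offZ => //; exact/cl_off/Lf.
Qed.

End Side.

(** [J] is strictly monotone, so it changes sign at [s0]; the intermediate value theorem is applied
    on both sides with the same height [al]. *)
Lemma balanced (J : R -> R) s0 e : 0 < e -> continuous J ->
  {in `[s0 - e, s0 + e] &, injective J} -> J s0 = 0 ->
  exists s1 s2, [/\ s0 - e <= s1 < s0, s0 < s2 <= s0 + e, J s1 = - J s2 & J s2 != 0].
Proof.
move=> e0 Jc Jinj J0.
have i0 : s0 \in `[s0 - e, s0 + e] by rewrite in_itv/=; apply/andP; split; lra.
have i1 : s0 - e \in `[s0 - e, s0 + e] by rewrite in_itv/=; apply/andP; split; lra.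
have i2 : s0 + e \in `[s0 - e, s0 + e] by rewrite in_itv/=; apply/andP; split; lra.
wlog lt : J Jc Jinj J0 / J (s0 - e) < 0 < J (s0 + e).
  move=> H.
  have [inc|dec] := itv_continuous_inj_mono (continuous_subspaceT Jc) Jinj.
    by apply: H => //; rewrite -J0 !inc//; lra.
  have [||||s1 [s2 [h1 h2 h3 h4]]] := H (fun s => - J s).
  - by move=> s; exact: (cvgN (Jc s)).
  - by move=> s t si ti /oppr_inj; exact: Jinj.
  - by rewrite J0 oppr0.
  - by rewrite oppr_lt0 oppr_gt0 -J0 !dec//; lra.
  by exists s1, s2; split => //; [apply: oppr_inj|rewrite -oppr_eq0].
have [lt1 lt2] := andP lt.
pose al := Order.min (- J (s0 - e)) (J (s0 + e)).
have al0 : 0 < al by rewrite lt_min oppr_gt0 lt1 lt2.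
have alu : al <= - J (s0 - e) by rewrite ge_min lexx.
have alv : al <= J (s0 + e) by rewrite ge_min lexx orbT.
have [|||s1] := @IVT _ J (s0 - e) s0 (- al).
- by lra.
- exact: continuous_subspaceT.
- by rewrite J0 ge_min le_max; apply/andP; split; apply/orP; [left|right]; lra.
rewrite in_itv/= => /andP[s1a s1b] Js1.
have [|||s2] := @IVT _ J s0 (s0 + e) al.
- by lra.
- exact: continuous_subspaceT.
- by rewrite J0 ge_min le_max; apply/andP; split; apply/orP; [left|right]; lra.
rewrite in_itv/= => /andP[s2a s2b] Js2.
exists s1, s2; split; rewrite ?Js1 ?Js2//; last by rewrite gt_eqF.
  by rewrite s1a lt_neqAle s1b andbT; apply: contra_eqN Js1 => /eqP->; rewrite J0; lra.
by rewrite s2b andbT lt_neqAle s2a andbT; apply: contra_eqN Js2 => /eqP<-; rewrite J0; lra.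
Qed.

End Lift.

(** * Crossing a closed curve *)

Section Affine.
Variable R : realType.
Local Notation P2 := (projective_plane R).
Variable k : 'I_3.
Implicit Types (y z : P2).

Definition aff y : R[i] :=
  (rep y 0 (k + 1) / rep y 0 k) +i* (rep y 0 (k + 1 + 1) / rep y 0 k).

Definition affvec y : 'rV[R]_3 := (rep y 0 k)^-1 *: rep y.

Lemma affvec_k y : rep y 0 k != 0 -> affvec y 0 k = 1.
Proof. by move=> yk; rewrite mxE mulVf. Qed.

Lemma affvec_cont (T : topologicalType) (Y : T -> P2) : continuous Y ->
  (forall x, rep (Y x) 0 k != 0) -> forall j, continuous (fun x => affvec (Y x) 0 j).
Proof.
move=> Yc Y0 j.
have pc i : continuous (fun x => proj (Y x) i k) by exact: (comp_cont Yc (@proj_continuous R i k)).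
have d0 x : dot (rep (Y x)) (rep (Y x)) != 0 by rewrite gt_eqF// dot_gt0// rep_neq0.
have p0 x : proj (Y x) k k != 0 by rewrite /proj !mulf_neq0// invr_eq0.
have -> : (fun x => affvec (Y x) 0 j) = fun x => proj (Y x) j k * (proj (Y x) k k)^-1.
  apply: funext => x; rewrite mxE /proj; have := d0 x.
  by move: (dot _ _) => d d00; field; rewrite Y0 d00.
by move=> x; exact: (cvgM (pc j x) (cvgV (p0 x) (pc k x))).
Qed.

Lemma aff_cont (T : topologicalType) (Y : T -> P2) : continuous Y ->
  (forall x, rep (Y x) 0 k != 0) -> ccont (fun x => aff (Y x)).
Proof.
move=> Yc Y0; have c := affvec_cont Yc Y0.
split.
  have -> : (fun x => complex.Re (aff (Y x))) = fun x => affvec (Y x) 0 (k + 1).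
    by apply: funext => x; rewrite mxE mulrC.
  exact: c.
have -> : (fun x => complex.Im (aff (Y x))) = fun x => affvec (Y x) 0 (k + 1 + 1).
  by apply: funext => x; rewrite mxE mulrC.
exact: c.
Qed.

Lemma aff_inj y z : rep y 0 k != 0 -> rep z 0 k != 0 -> aff y = aff z -> y = z.
Proof.
move=> y0 z0 [e1 e2]; apply: (@rep_inj _ _ _ (rep y 0 k / rep z 0 k)).
apply: (row3_ext (k := k)); rewrite mxE; first by rewrite divfK.
  by rewrite mulrAC -mulrA -e1 mulrC divfK.
by rewrite mulrAC -mulrA -e2 mulrC divfK.
Qed.

(** Up to a real factor, the direction of [z] seen along [y] is the chord between them in the affine
    chart. *)
Lemma trace_aff y z c : rep y 0 k != 0 -> rep z 0 k != 0 ->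
  trace k (affvec y) (c *: rep z) = (c * rep z 0 k)%:C * (aff z - aff y).
Proof.
move=> y0 z0; apply/eqP; rewrite eq_complex cReM cImM /trace !mxE/=.
by apply/andP; split; apply/eqP; field; rewrite y0 z0.
Qed.

End Affine.

(** * The side along a second curve, and its change at a crossing *)

Section Oddness.
Variable R : realType.
Local Notation P2 := (projective_plane R).
Local Notation Re := (@complex.Re R).
Local Notation Im := (@complex.Im R).

(** Without [x], the curve [M] is an arc that avoids [L]; if [x] is not the base point, its two
    pieces are joined at the base point. As [m] is not negative, the side does not depend on the
    lift. *)
Lemma cl_side_cross L f g m M f' g' m' x :
  closed_lift L f g m -> closed_lift M f' g' m' -> L `&` M = [set x] ->
  (m < 0) = false -> forall y y' : P2, M y -> M y' -> y <> x -> y' <> x ->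
  side g m (rep y) = side g m (rep y').
Proof.
move=> cl cl' LM m0.
have offL t : 0 <= t <= 1 -> f' t <> x -> ~ L (f' t).
  move=> tab ftx Lf; apply: ftx; have : (L `&` M) (f' t).
    by split => //; rewrite (cl_im cl'); exists t => //=; rewrite in_itv.
  by rewrite LM.
pose S t := side g m (g' t).
have SE t : 0 <= t <= 1 -> f' t <> x -> S t = side g m (rep (f' t)).
  move=> tab ftx; rewrite /S; have [c c0 ->] := cl_rep cl' tab.
  by rewrite (cl_sideZ cl c0 (offL _ tab ftx)) m0 addbF.
suff H t t' : 0 <= t <= 1 -> 0 <= t' <= 1 -> f' t <> x -> f' t' <> x -> S t = S t'.
  move=> y y'; rewrite (cl_im cl') => -[t /= +] <- [t' /= +] <-; rewrite !in_itv/=.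
  by move=> tab tab' h h'; rewrite -!SE//; exact: H.
have i0 : 0 <= (0 : R) <= 1 by apply/andP; split; lra.
have i1 : 0 <= (1 : R) <= 1 by apply/andP; split; lra.
have [t0 t0i t0x] : exists2 t0, 0 <= t0 < 1 & f' t0 = x.
  have : (L `&` M) x by rewrite LM.
  move=> [_]; rewrite (cl_im cl') => -[t1 /=]; rewrite in_itv/= => /andP[h1 h2] e.
  have [t11|t11] := eqVneq t1 1; last by exists t1; rewrite // h1 lt_neqAle t11.
  by exists 0; rewrite ?lexx ?ltr01// (cl_loop cl') -t11.
have ne u : 0 <= u < 1 -> u != t0 -> f' u <> x.
  move=> u01 ut; rewrite -t0x => /(cl_inj cl'); rewrite !in_itv/= => /(_ u01 t0i) e.
  by rewrite e eqxx in ut.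
have [t00|t00] := eqVneq t0 0.
  move=> /andP[t1 t2] /andP[t3 t4] ft ft'.
  have t1' : 0 < t.
    by rewrite lt_neqAle t1 andbT; apply: contra_notN ft => /eqP <-; rewrite -t00.
  have t3' : 0 < t'.
    by rewrite lt_neqAle t3 andbT; apply: contra_notN ft' => /eqP <-; rewrite -t00.
  have t2' : t < 1.
    by rewrite lt_neqAle t2 andbT; apply: contra_notN ft => /eqP ->; rewrite -(cl_loop cl') -t00.
  have t4' : t' < 1.
    by rewrite lt_neqAle t4 andbT; apply: contra_notN ft' => /eqP ->; rewrite -(cl_loop cl') -t00.
  apply: (cl_side_arc cl (a := Order.min t t') (b := Order.max t t') cl').
  - by rewrite le_min t1 t3.
  - by rewrite ge_max t2 t4.
  - move=> u; rewrite ge_min le_max => /andP[/orP u1 /orP u2].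
    have u01 : 0 < u < 1 by apply/andP; split; case: u1; case: u2 => *; lra.
    move/andP: u01 => [u3 u4]; apply: offL; first by rewrite (ltW u3) (ltW u4).
    by apply: ne; rewrite ?(ltW u3)// t00 gt_eqF.
  - by rewrite ge_min le_max lexx.
  - by rewrite ge_min le_max lexx !orbT.
have f0x : f' 0 <> x by apply: ne; rewrite ?lexx ?ltr01// eq_sym.
have f1x : f' 1 <> x by rewrite -(cl_loop cl').
have S10 : S 1 = S 0 by rewrite !SE// (cl_loop cl').
suff H u : 0 <= u <= 1 -> f' u <> x -> S u = S 0.
  by move=> *; rewrite H// [RHS]H.
move=> /andP[u0 u1] fux; have ut0 : u != t0 by apply: contra_notN fux => /eqP->.
move: ut0; rewrite neq_lt => /orP[ut|ut].
  apply: (cl_side_arc cl (a := 0) (b := u) cl'); rewrite ?lexx ?u0//.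
  move=> v /andP[v0 vu]; apply: offL; first by apply/andP; split; lra.
  apply: ne; first by apply/andP; split; lra.
  by rewrite lt_eqF//; lra.
rewrite -S10; apply: (cl_side_arc cl (a := u) (b := 1) cl'); rewrite ?lexx ?u1//.
move=> v /andP[v0 vu]; apply: offL; first by apply/andP; split; lra.
have [->//|v1] := eqVneq v 1.
apply: ne; first by rewrite lt_neqAle v1 vu andbT; lra.
by rewrite gt_eqF//; lra.
Qed.

Lemma near0_pos (Q : set R) r : 0 < r -> (\forall b \near 0, Q b) ->
  exists2 b, 0 < b <= r & Q b.
Proof.
move=> r0 [d /= d0 H]; exists (Order.min (d / 2) r).
  by rewrite lt_min ge_min lexx orbT andbT r0 divr_gt0.
apply: H; rewrite /= sub0r normrN ger0_norm; last by rewrite le_min (ltW r0) divr_ge0 ?ltW.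
by rewrite gt_min ltr_pdivrMr// mulrC ltr_pMl// ltr1n.
Qed.

Lemma pos_in_segment (a r : R) : 0 < a <= r -> - r <= a <= r /\ - r <= - a <= r.
Proof. by move=> /andP[? ?]; split; apply/andP; split; lra. Qed.

Section Flip.
Variables (L : set P2) (f : R -> P2) (g : R -> 'rV[R]_3) (m : R).
Variables (h : R -> R -> P2) (k : 'I_3) (r s0 e : R) (J : R -> R).
Hypothesis cl : closed_lift L f g m.
Hypothesis m0 : 0 < m.
Hypothesis e0 : 0 < e.
Hypothesis s0e : 0 < s0 - e /\ s0 + e < 1.
Hypothesis hc : continuous (fun z : R * R => h z.1 z.2).
Hypothesis hk : forall a b, rep (h a b) 0 k != 0.
Hypothesis h_inj : forall a b a' b', - r <= a <= r -> - r <= b <= r ->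
  - r <= a' <= r -> - r <= b' <= r -> h a b = h a' b' -> a = a' /\ b = b'.
Hypothesis Jc : continuous J.
Hypothesis J0 : J s0 = 0.
Hypothesis Jr : forall s, - r <= J s <= r.
Hypothesis fJ : forall s, s0 - e <= s <= s0 + e -> f s = h (J s) 0.
Hypothesis f_s0 : forall s, 0 <= s <= 1 -> s != s0 -> f s <> h 0 0.
Hypothesis offL : forall b, - r <= b <= r -> b != 0 -> ~ L (h 0 b).

(** If the sides were equal, the quotient of the directions seen along [h 0 b] and [h 0 (- b)] would
    have a root [H] with a positive factor over the loop. For small [b], [Re H] keeps its sign away
    from the crossing, hence has the same sign at [s1] and [s2]. Between them the quotient is a
    chord ratio, whose root changes the sign of its real part by [chord_ratio_ends]. *)
Lemma side_flip : exists b, [/\ - r <= b <= r, b != 0 &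
  side g m (rep (h 0 b)) != side g m (rep (h 0 (- b)))].
Proof.
pose G a b := aff k (h a b).
have Gc : ccont (fun z : R * R => G z.1 z.2) by exact: aff_cont.
have G_inj a b a' b' : - r <= a <= r -> - r <= b <= r ->
    - r <= a' <= r -> - r <= b' <= r -> G a b = G a' b' -> a = a' /\ b = b'.
  by move=> ar br ar' br' /aff_inj h'; apply: h_inj => //; apply: h'.
pose P b := affvec k (h 0 b).
have pairc : continuous (fun b : R => (0 : R, b)).
  have c0 : continuous (fun _ : R => 0 : R) by move=> b; exact: cvg_cst.
  have idc : continuous (fun b : R => b) by move=> b; exact: cvg_id.
  by move=> b; exact: (cvg_pair (c0 b) (idc b)).
have Pc j : continuous (fun b => P b 0 j).
  apply: affvec_cont => //; exact: (comp_cont pairc hc).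
pose F b s := trace k (P b) (g s).
have Fc (T : topologicalType) (b s : T -> R) : continuous b -> continuous s ->
    ccont (fun x => F (b x) (s x)).
  move=> bc sc; apply: ccont_trace => j; first exact: (comp_cont bc (Pc j)).
  exact: (comp_cont sc (cl_gcont cl (j := j))).
have mE : (m < 0) = false by rewrite lt_gtF.
have [|s1 [s2 [/andP[s1e s1s] /andP[s2s s2e] J12 J2]]] := balanced e0 Jc _ J0.
  move=> s t; rewrite !in_itv/= => sI tI Jst.
  have [d1 d2] := s0e.
  have : f s = f t by rewrite !fJ// Jst.
  move/(cl_inj cl); apply; rewrite in_itv/=;
    [move/andP: sI => [? ?]|move/andP: tI => [? ?]]; apply/andP; split; lra.
have [d1 d2] := s0e.
have [s10 s12 s21] : [/\ 0 <= s1, s1 <= s2 & s2 <= 1] by split; lra.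
have sub01 s : s1 <= s <= s2 -> 0 <= s <= 1.
  by case/andP => sa sb; rewrite (le_trans s10 sa) (le_trans sb s21).
have subI s : s1 <= s <= s2 -> s0 - e <= s <= s0 + e.
  by case/andP => sa sb; rewrite (le_trans s1e sa) (le_trans sb s2e).
have i0 : 0 <= (0 : R) <= 1 by rewrite lexx ler01.
have i1 : 0 <= (1 : R) <= 1 by rewrite ler01 lexx.
(* At [b = 0] both directions coincide, and they vanish only where the curve passes through
   [h 0 0]. *)
have far s : (0 <= s <= s1) || (s2 <= s <= 1) ->
    forall b, b = 0 -> 0 < Re (F b s * (F (- b) s)^*%C).
  move=> hs b ->; rewrite oppr0; suff : 0 < F 0 s * (F 0 s)^*%C.
    by rewrite gt0_complex => /andP[].
  apply: mulcJ_gt0; apply/eqP => F0.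
  have s01 : 0 <= s <= 1.
    by case/orP: hs => /andP[? ?]; apply/andP; split; lra.
  have ss0 : s != s0.
    by case/orP: hs => /andP[? ?]; rewrite neq_lt; apply/orP; [left|right]; lra.
  have := f_s0 s01 ss0; apply.
  have [c c0 ge] := cl_rep cl s01.
  have /trace_eq0 := F0; rewrite affvec_k// oner_eq0 => /(_ isT).
  rewrite /P /affvec scalerA ge => e1.
  apply: (@rep_inj _ _ _ (c^-1 * (g s 0 k / 1 / rep (h 0 0) 0 k))).
  by rewrite -scalerA ge -e1 scalerA mulVf// scale1r.
pose al := `|J s2|.
have al0 : 0 < al by rewrite normr_gt0.
have alr : al <= r by rewrite ler_norml.
have near_far a b : (forall s, a <= s <= b -> (0 <= s <= s1) || (s2 <= s <= 1)) ->
    \forall b' \near 0, forall s, a <= s <= b -> 0 < Re (F b' s * (F (- b') s)^*%C).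
  move=> ab; apply: (near_segment (Q := fun s b' => Re (F b' s * (F (- b') s)^*%C))).
    have fstc : continuous (@fst R R) by move=> z; exact: cvg_fst.
    have sndc : continuous (@snd R R) by move=> z; exact: cvg_snd.
    have nsndc : continuous (fun z : R * R => - z.2) by move=> z; exact: (cvgN (sndc z)).
    suff [] : ccont (fun z : R * R => F z.2 z.1 * (F (- z.2) z.1)^*%C) by [].
    by apply: ccontM; [|apply: ccont_conj]; exact: Fc.
  by move=> s sab; apply: far => //; exact: ab.
have near_end a : - r <= a <= r -> a != 0 -> \forall b \near 0, forall u, 0 <= u <= 1 ->
    0 < Re (chord_ratio G b u a).
  move=> ar a0; apply: (near_segment (Q := fun u b => Re (chord_ratio G b u a))).
    have fstc : continuous (@fst R R) by move=> z; exact: cvg_fst.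
    have sndc : continuous (@snd R R) by move=> z; exact: cvg_snd.
    suff [] : ccont (fun z : R * R => chord_ratio G z.2 z.1 a) by [].
    by apply: (ccont_chord_ratio Gc (u := fst) (b := snd) (a := fun=> a)) => // z;
      exact: cvg_cst.
  move=> u u01; rewrite /chord_ratio oppr0.
  have := mulcJ_gt0 (chord_neq0 G_inj u01 ar (_ : - r <= 0 <= r) (_ : (a != 0) || (0 != 0))).
  rewrite gt0_complex a0 => H; apply: (andP (H _ _)).2 => //.
  by apply/andP; split; lra.
have alP : 0 < al <= r by rewrite al0 alr.
have [alI nalI] := pos_in_segment alP.
(* Four open conditions on [b]: the two directions are close on both outer arcs, and the chord ratio
   is in the right half-plane at [al] and at [- al] for all [u]. *)
have n1 := near_far 0 s1 (fun s hs => introT orP (or_introl hs)).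
have n2 := near_far s2 1 (fun s hs => introT orP (or_intror hs)).
have n3 := near_end al alI (lt0r_neq0 al0).
have n4 : \forall b \near 0, forall u, 0 <= u <= 1 -> 0 < Re (chord_ratio G b u (- al)).
  by apply: near_end => //; rewrite oppr_eq0 lt0r_neq0.
have [b bP [[far1 far2] [end1 end2]]] :=
  near0_pos (lt_le_trans al0 alr) (filterI (filterI n1 n2) (filterI n3 n4)).
have [bI nbI] := pos_in_segment bP.
have [b0 br] := andP bP.
exists b; split => //; first by rewrite gt_eqF.
have bN : b != 0 by rewrite gt_eqF.
have nbN : - b != 0 by rewrite oppr_eq0.
have offP c : - r <= c <= r -> c != 0 -> off g (P c).
  by move=> cr c0; apply: offZ; [rewrite invr_eq0|exact/(cl_off cl)/offL].
have Pk c : P c 0 k = 1 by rewrite affvec_k.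
have F0 c : - r <= c <= r -> c != 0 -> forall s, 0 <= s <= 1 -> F c s != 0.
  move=> cr c0 s s01; apply: trace_neq0 => //; [exact: cl_neq0 cl|exact: offP|].
  by rewrite Pk oner_eq0.
have sideF c : - r <= c <= r -> c != 0 -> side g m (rep (h 0 c)) = turn (F c).
  move=> cr c0; transitivity (side g m (P c)).
    by rewrite /P /affvec (cl_sideZ cl) ?invr_eq0//; [rewrite mE addbF|exact: offL].
  rewrite (sideE (cl_gcont cl) (cl_neq0 cl) (cl_m0 cl) (cl_g1 cl) (offP _ cr c0) (k := k)).
    by rewrite /side_at mE addbF.
  by rewrite Pk oner_eq0.
have Fcc c : ccont (F c) by apply: Fc => // s; [exact: cvg_cst|exact: cvg_id].
have F1 c : F c 1 = m%:C * F c 0 by rewrite /F (cl_g1 cl) traceZr.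
rewrite !sideF//; apply/eqP => E.
have [H HP H01] := turn_eq_root m0 (Fcc b) (Fcc (- b)) (F1 b) (F1 (- b))
  (F0 b bI bN) (F0 (- b) nbI nbN) E.
have ReH s : 0 <= s <= 1 -> (0 <= s <= s1) || (s2 <= s <= 1) -> Re (H s) != 0.
  move=> s01 hs; have : 0 < Re (F b s * (F (- b) s)^*%C).
    by case/orP: hs; [exact: far1|exact: far2].
  move/rootc_Re/(_ (HP.2 _ s01)); apply: contraTneq => ->.
  by rewrite expr0n/= -leNgt sqr_ge0.
have arc a c : 0 <= a -> c <= 1 ->
    (forall s, a <= s <= c -> (0 <= s <= s1) || (s2 <= s <= 1)) ->
    forall s t, a <= s <= c -> a <= t <= c -> 0 < Re (H s) * Re (H t).
  move=> a0 c1 ac; apply: (@const_sign _ (fun s => Re (H s))).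
    by move=> t _; exact: HP.1.1.
  move=> t tac; apply: ReH; last exact: ac.
  by case/andP: tac => at' tc; rewrite (le_trans a0 at') (le_trans tc c1).
have h1 : 0 < Re (H 0) * Re (H s1).
  apply: (arc 0 s1); rewrite ?lexx ?s10 ?(le_trans s12 s21)//.
  by move=> s ->.
have h2 : 0 < Re (H s2) * Re (H 1).
  apply: (arc s2 1); rewrite ?lexx ?s21 ?(le_trans s10 s12)//.
  by move=> s ->; rewrite orbT.
have h3 : 0 < Re (H 0) * Re (H 1).
  have [_ H0] := rootc_neq0 (HP.2 _ i0).
  move: H0 H01; rewrite complex_neq0 gt0_complex cReM cImM cReJ cImJ.
  have := ReH _ i0; rewrite lexx s10 => /(_ isT) x0.
  move: (H 0) (H 1) x0 => [x y] [u v] /= x0 n0 /andP[/eqP e1 e2].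
  have : 0 < x * u * (x ^+ 2 + y ^+ 2).
    have -> : x * u * (x ^+ 2 + y ^+ 2) =
        x ^+ 2 * (u * x - v * - y) - x * y * (u * - y + v * x) by ring.
    by rewrite e1 mulr0 subr0 mulr_gt0// exprn_even_gt0.
  by rewrite pmulr_lgt0.
have h4 : 0 < Re (H s1) * Re (H s2).
  rewrite -(pmulr_rgt0 _ h3) -(pmulr_lgt0 _ (mulr_gt0 h1 h2)).
  have -> : Re (H 0) * Re (H 1) * (Re (H s1) * Re (H s2)) *
      (Re (H 0) * Re (H s1) * (Re (H s2) * Re (H 1))) =
      (Re (H 0) * Re (H s1) * (Re (H s2) * Re (H 1))) ^+ 2 by ring.
  by rewrite exprn_gt0// mulr_gt0.
have [||K KP] := @root_on_exists _ (- r) r (chord_ratio G b 0) _ _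
    (fun a ar => chord_ratio_neq0 G_inj bP i0 ar).
- by rewrite (le_trans (andP alI).1)// alr.
- apply: (ccont_chord_ratio Gc (b := fun=> b) (u := fun=> 0) (a := fun x => x)) => x;
    do ?exact: cvg_cst.
  exact: cvg_id.
(* Here the curve is [h (J s) 0], so by [trace_aff] the quotient is a positive multiple of the chord
   ratio at [u = 0] and [a = J s]. *)
have KJ : root_on s1 s2 (fun s => F b s * (F (- b) s)^*%C) (fun s => K (J s)).
  split; first exact: (ccont_comp Jc KP.1).
  move=> s ss; have KPs := KP.2 _ (Jr s).
  have [c c0 ge] := cl_rep cl (sub01 _ ss).
  rewrite /F ge (fJ (subI _ ss)) !trace_aff//; set x := (c * _).
  have x0 : x != 0 by rewrite mulf_neq0.
  rewrite conjcM mulrACA conjc_real -rmorphM rootc_scale; last first.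
    by rewrite ltcR -expr2 exprn_even_gt0.
  move: KPs; rewrite /chord_ratio /chord /G; congr (rootc _ _).
  by rewrite !(mul0r, oppr0, addr0, mulr1).
have HP' : root_on s1 s2 (fun s => F b s * (F (- b) s)^*%C) H.
  split; first exact: HP.1.
  by move=> s /sub01; exact: HP.2.
have j1 : s1 <= s1 <= s2 by rewrite lexx s12.
have j2 : s1 <= s2 <= s2 by rewrite lexx s12.
move: h4; rewrite (root_on_Re_sign HP' KJ j1 j2).
have Kneg : Re (K (- al)) * Re (K al) < 0.
  apply: (chord_ratio_ends Gc G_inj alP bP _ KP) => u u01.
  by split; [exact: end1|exact: end2].
rewrite J12; move: Kneg; rewrite /al; case: (ger0P (J s2)) => _ Kneg.
  by rewrite lt_gtF.
by rewrite opprK in Kneg; rewrite mulrC lt_gtF.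
Qed.

End Flip.
End Oddness.

Section Odd.
Variable R : realType.
Local Notation P2 := (projective_plane R).

(** For [m > 0], [side_flip] changes the side along [M] across [x], whereas [cl_side_cross] makes it
    constant. The assumption on [f 0] puts the crossing in the interior of the parameter
    interval. *)
Lemma lift_odd (L M : set P2) f g m f' g' m' x :
  closed_lift L f g m -> closed_lift M f' g' m' -> L `&` M = [set x] ->
  cross_at R L M x -> x <> f 0 -> m < 0.
Proof.
move=> cl cl' LM [U [phi [oU Ux [phic [h [hc hU hphi phih]]] phix UE]]] xf0.
have [//|mE] := boolP (m < 0); exfalso.
have mp : 0 < m by rewrite lt_neqAle eq_sym (cl_m0 cl) leNgt.
have h0x : h (0, 0) = x by rewrite -phix hphi.
have [k xk] : exists k, rep x 0 k != 0.
  apply: contrapT => H; have /eqP := rep_neq0 x; apply; apply/rowP => j.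
  by rewrite mxE; apply/eqP/negPn/negP => xj; apply: H; exists j.
(* The square of half-width [r] is mapped into one affine chart of the projective plane. *)
have [r r0 hk] : exists2 r : R, 0 < r & forall z : R * R,
    `|z.1| <= r -> `|z.2| <= r -> rep (h z) 0 k != 0.
  have pc : continuous (fun z => proj (h z) k k) by exact: (comp_cont hc (@proj_continuous R k k)).
  have p0 : 0 < proj (h (0, 0)) k k.
    by rewrite h0x /proj divr_gt0 ?dot_gt0 ?rep_neq0// -expr2 exprn_even_gt0.
  have H : \forall z \near ((0, 0) : R * R), 0 < proj (h z) k k.
    exact: (cvgr_gt _ (pc (0, 0)) _ p0).
  have [[A B] /= [[d1 /= d10 HA] [d2 /= d20 HB]] H'] := H.
  pose d := Order.min d1 d2.
  have d0 : 0 < d by rewrite lt_min d10.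
  have dd1 : d <= d1 by rewrite ge_min lexx.
  have dd2 : d <= d2 by rewrite ge_min lexx orbT.
  exists (d / 2); first by rewrite divr_gt0.
  move=> [a b] /= ad bd; have : 0 < proj (h (a, b)) k k.
    by apply: H'; split => /=; [apply: HA|apply: HB]; rewrite /= sub0r normrN; lra.
  by apply: contraTneq => e; rewrite /proj e mul0r mul0r ltxx.
have rr : - r <= r by lra.
(* Clamping makes the conditions on the square hold on the whole plane. *)
pose h' a b := h (clamp (- r) r a, clamp (- r) r b).
have ck a : `|clamp (- r) r a| <= r by rewrite ler_norml clamp_in.
have h'E a b : - r <= a <= r -> - r <= b <= r -> h' a b = h (a, b).
  by move=> /clamp_id + /clamp_id; rewrite /h' => -> ->.
have h'c : continuous (fun z : R * R => h' z.1 z.2).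
  have pc : continuous (fun z : R * R => (clamp (- r) r z.1, clamp (- r) r z.2)).
    have fc : continuous (@fst R R) by move=> z; exact: cvg_fst.
    have sc : continuous (@snd R R) by move=> z; exact: cvg_snd.
    have cc := @clamp_cont R (- r) r.
    have c1 : continuous (fun z : R * R => clamp (- r) r z.1) by exact: (comp_cont fc cc).
    have c2 : continuous (fun z : R * R => clamp (- r) r z.2) by exact: (comp_cont sc cc).
    by move=> z; exact: (cvg_pair (c1 z) (c2 z)).
  exact: (comp_cont pc hc).
have h'_inj a b a' b' : - r <= a <= r -> - r <= b <= r ->
    - r <= a' <= r -> - r <= b' <= r -> h' a b = h' a' b' -> a = a' /\ b = b'.
  by move=> ar br ar' br'; rewrite !h'E// => /(congr1 phi); rewrite !phih => -[].
have i0 : - r <= 0 <= r by apply/andP; split; lra.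
have offL b : - r <= b <= r -> b != 0 -> ~ L (h' 0 b).
  move=> br b0; rewrite h'E// => Lh.
  have [[+ _] _] := UE _ (hU (0, b)).
  by move=> /(_ Lh); rewrite phih/= => /eqP; rewrite (negbTE b0).
have [s0 s01 fs0] : exists2 s0, 0 <= s0 <= 1 & f s0 = x.
  have : (L `&` M) x by rewrite LM.
  by move=> [+ _]; rewrite (cl_im cl) => -[s /=]; rewrite in_itv/=; exists s.
have s00 : s0 != 0 by apply/eqP => e; apply: xf0; rewrite -fs0 e.
have s01' : s0 != 1 by apply/eqP => e; apply: xf0; rewrite -fs0 e (cl_loop cl).
have [s0p s0q] : 0 < s0 /\ s0 < 1.
  by move/andP: s01 => [? ?]; rewrite !lt_neqAle eq_sym s00 s01'.
have phi1c y : U y -> {for y, continuous (fun y => (phi y).1)}.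
  move=> Uy; have : {in U, continuous phi} by rewrite -continuous_open_subspace.
  move=> /(_ y); rewrite inE => /(_ Uy) c.
  exact: (cvg_comp _ _ c (@cvg_fst _ _ _ _ _)).
have [e [e0 es Us Js]] : exists e : R, [/\ 0 < e, 0 < s0 - e /\ s0 + e < 1,
    forall s, s0 - e <= s <= s0 + e -> U (f s) &
    forall s, s0 - e <= s <= s0 + e -> - r <= (phi (f s)).1 <= r].
  have n1 : \forall s \near s0, U (f s).
    apply: (cl_cont cl); rewrite fs0; exact: open_nbhs_nbhs.
  have fphic : {for s0, continuous (fun s => (phi (f s)).1)}.
    apply: (continuous_comp (g := fun y => (phi y).1)); first exact: cl_cont cl _.
    by apply: phi1c; rewrite fs0.
  have n2 : \forall s \near s0, (phi (f s)).1 < r.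
    by apply: (cvgr_lt _ fphic); rewrite fs0 phix.
  have n3 : \forall s \near s0, - r < (phi (f s)).1.
    by apply: (cvgr_gt _ fphic); rewrite fs0 phix oppr_lt0.
  have [d /= d0 H] := filterI n1 (filterI n2 n3).
  pose e := Order.min (d / 2) (Order.min (s0 / 2) ((1 - s0) / 2)).
  have e1 : e <= d / 2 by rewrite ge_min lexx.
  have e2 : e <= s0 / 2 by rewrite !ge_min lexx orbT.
  have e3 : e <= (1 - s0) / 2 by rewrite !ge_min lexx !orbT.
  have e0 : 0 < e by rewrite !lt_min; apply/and3P; split; lra.
  have near_s s : s0 - e <= s <= s0 + e -> ball s0 d s.
    by move=> /andP[? ?]; rewrite /ball/= ltr_norml; apply/andP; split; lra.
  exists e; split => //.
  - by split; lra.
  - by move=> s /near_s/H[].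
  - by move=> s /near_s/H[_ [/ltW h2 /ltW h3]]; rewrite h2 h3.
have ee : s0 - e <= s0 + e by lra.
pose J s := (phi (f (clamp (s0 - e) (s0 + e) s))).1.
have Jc : continuous J.
  apply: (within_clamp (f := fun s => (phi (f s)).1)) => //.
  apply: continuous_in_subspaceT => s; rewrite inE/= in_itv/= => /Us Ufs.
  apply: (continuous_comp (g := fun y => (phi y).1)); first exact: cl_cont cl _.
  exact: phi1c.
have Jr s : - r <= J s <= r by apply: Js; exact: clamp_in.
have J0 : J s0 = 0.
  by rewrite /J clamp_id ?fs0 ?phix//; apply/andP; split; lra.
have fJ s : s0 - e <= s <= s0 + e -> f s = h' (J s) 0.
  move=> sI; rewrite h'E// /J clamp_id//.
  have [[+ _] _] := UE _ (Us _ sI); have [q1 q2] := es.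
  have Lf : L (f s).
    rewrite (cl_im cl); exists s => //=; rewrite in_itv/=.
    by move/andP: sI => [? ?]; apply/andP; split; lra.
  move=> /(_ Lf) p2; rewrite -[LHS](hphi _ (Us _ sI)); congr h.
  by move: p2; case: (phi (f s)) => a b /= ->.
have f_s0 s : 0 <= s <= 1 -> s != s0 -> f s <> h' 0 0.
  move=> /andP[sa sb] ss0; rewrite h'E// h0x -fs0 => e1.
  have [s1|s1] := eqVneq s 1.
    by apply: xf0; rewrite -fs0 -e1 s1 (cl_loop cl).
  move: ss0; rewrite ((cl_inj cl) _ _ _ _ e1) ?eqxx// in_itv/=.
    by rewrite sa lt_neqAle s1.
  by rewrite (ltW s0p).
have hk' a b : rep (h' a b) 0 k != 0 by apply: hk; exact: ck.
have [b [br b0]] := side_flip cl mp e0 es h'c hk' h'_inj Jc J0 Jr fJ f_s0 offL.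
have onM c : - r <= c <= r -> c != 0 -> M (h' 0 c) /\ h' 0 c <> x.
  move=> cr c0; split; first by have [_ [_ +]] := UE _ (hU (0, c)); rewrite h'E// phih; apply.
  rewrite h'E// -h0x => /(congr1 phi); rewrite !phih => -[] /eqP.
  by rewrite (negbTE c0).
have nbr : - r <= - b <= r by move/andP: br => [? ?]; apply/andP; split; lra.
have [m1 m2] := onM _ br b0; have [|m3 m4] := onM _ nbr; first by rewrite oppr_eq0.
by rewrite (cl_side_cross cl cl' LM (negbTE mE) m1 m3 m2 m4) eqxx.
Qed.

End Odd.

(** * Pseudoline arrangements *)

Section Arrangement.
Variable R : realType.
Local Notation P2 := (projective_plane R).

(** The side is constant before and after [t]. It changes at [t] because [g' 1] is a negative
    multiple of [g' 0] and the side is odd. *)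
Lemma line_sides (L N : set P2) f g m f' g' m' t :
  closed_lift L f g m -> closed_lift N f' g' m' -> m < 0 -> m' < 0 ->
  0 <= t < 1 -> (forall x, L x -> N x -> x = f' t) ->
  exists e, forall s, 0 <= s < 1 -> s != t -> side g m (g' s) = e (+) (s < t).
Proof.
move=> cl cl' m0 m'0 t01 LN; have [t0 t1] := andP t01.
have offL s : 0 <= s < 1 -> s != t -> ~ L (f' s).
  move=> s01 st Lf; have [h0 h1] := andP s01.
  have : f' s = f' t.
    by apply: LN => //; rewrite (cl_im cl'); exists s => //=; rewrite in_itv/= h0 ltW.
  by move/(cl_inj cl'); rewrite !in_itv/= => /(_ s01 t01) e; rewrite e eqxx in st.
have arc a b : 0 <= a -> b <= 1 -> (forall u, a <= u <= b -> ~ L (f' u)) ->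
    forall s s', a <= s <= b -> a <= s' <= b -> side g m (g' s) = side g m (g' s').
  by move=> a0 b1 H s s'; exact: (cl_side_arc cl cl' a0 b1 H).
have [te|tn] := eqVneq t 0.
  (* For [t = 0] a single open arc remains, and any parameter inside it gives [e]. *)
  exists (side g m (g' 2^-1)) => s /andP[s0 s1] st.
  have sp : 0 < s by rewrite lt_neqAle eq_sym -{1}te st.
  rewrite te ltNge s0 addbF.
  apply: (arc (Order.min s 2^-1) (Order.max s 2^-1)).
  - by rewrite le_min s0 invr_ge0 ler0n.
  - by rewrite ge_max (ltW s1); lra.
  - move=> u; rewrite ge_min le_max => /andP[/orP u1 /orP u2].
    have /andP[u3 u4] : 0 < u < 1 by apply/andP; split; case: u1; case: u2 => *; lra.
    by apply: offL; rewrite ?(ltW u3)// te gt_eqF.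
  - by rewrite ge_min le_max lexx.
  - by rewrite ge_min le_max lexx !orbT.
have f0 : ~ L (f' 0) by apply: offL; rewrite ?lexx ?ltr01// eq_sym.
have S10 : side g m (g' 1) = ~~ side g m (g' 0).
  have i0 : 0 <= (0 : R) <= 1 by apply/andP; split; lra.
  have [c c0 ge] := cl_rep cl' i0.
  rewrite (cl_g1 cl') ge scalerA !(cl_sideZ cl)//; last first.
    by rewrite mulf_neq0// (cl_m0 cl').
  rewrite m0/= nmulr_rlt0//; move: c0; rewrite neq_lt => /orP[h|h];
    by rewrite h (lt_gtF h) ?addbT ?addbF ?negbK.
exists (~~ side g m (g' 0)) => s s01 st; have [s0 s1] := andP s01.
move: st; rewrite neq_lt => /orP[st|st].
  rewrite st addbT negbK; apply: (arc 0 s); rewrite ?lexx ?s0 ?(ltW s1)//.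
  move=> u /andP[u0 us]; apply: offL; first by rewrite u0 (le_lt_trans us).
  by rewrite lt_eqF// (le_lt_trans us).
rewrite (lt_gtF st) addbF -S10; apply: (arc s 1); rewrite ?lexx ?(ltW s1)//.
move=> u /andP[u0 u1]; have [->|un] := eqVneq u 1; first by rewrite -(cl_loop cl').
apply: offL; first by rewrite (le_trans s0 u0) lt_neqAle un.
by rewrite gt_eqF// (lt_le_trans st).
Qed.

(** * From a realization to the combinatorial data *)

Section Realization.
Variables (C : configuration) (pt : config_point C -> P2) (pl : config_line C -> set P2).
Local Notation Pt := (config_point C).
Local Notation Ln := (config_line C).
Local Notation inc := (@incident C).
Hypothesis real : topological_realization pt pl.
Hypothesis lines_meet : forall l l' : Ln, l != l' -> exists p : Pt, inc p l && inc p l'.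
Hypothesis triple : forall p : Pt, #|[set l | inc p l]%SET| = 3%N.
Hypothesis card_lines : (3 < #|Ln|)%N.

Lemma inc_pl p l : inc p l -> pl l (pt p).
Proof. by case: real => _ _ _ H /H. Qed.

Lemma common_point p l l' : l != l' -> inc p l -> inc p l' ->
  pl l `&` pl l' = [set pt p] /\ cross_at R (pl l) (pl l') (pt p).
Proof.
move=> ll' pl1 pl2; have [pl_inj [_ _ arr] _ _] := real.
have [||ne|x [e cr]] := arr (pl l) (pl l'); [by exists l|by exists l'| |].
  by move/pl_inj : ne => e; rewrite e eqxx in ll'.
have : (pl l `&` pl l') (pt p) by split; exact: inc_pl.
by rewrite e => /= ->.
Qed.

Lemma unique_common p q l l' : l != l' -> inc p l -> inc p l' -> inc q l ->
  inc q l' -> p = q.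
Proof.
move=> ll' p1 p2 q1 q2; have [_ _ pt_inj _] := real; apply: pt_inj.
have [e _] := common_point ll' q1 q2.
have : (pl l `&` pl l') (pt p) by split; exact: inc_pl.
by rewrite e.
Qed.

Lemma lifts : exists (f : Ln -> R -> P2) (g : Ln -> R -> 'rV[R]_3) (m : Ln -> R),
  forall l, closed_lift (pl l) (f l) (g l) (m l).
Proof.
have /choice[F FP] : forall l, exists F : (R -> P2) * (R -> 'rV[R]_3) * R,
    closed_lift (pl l) F.1.1 F.1.2 F.2.
  move=> l; have [_ [_ ps _] _ _] := real.
  have [] := ps (pl l); first by exists l.
  by move=> /closed_curve_lift[f [g [m H]]] _; exists (f, g, m).
by exists (fun l => (F l).1.1), (fun l => (F l).1.2), (fun l => (F l).2).
Qed.

Lemma not_realization : False.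
Proof.
have [f [g [m cl]]] := lifts.
have m0 l : m l < 0.
  (* [lift_odd] needs a crossing other than the base point; of two points on [l], at most one is the
     base point. *)
  have [q ql qf] : exists2 q, inc q l & pt q <> f l 0.
    have [p pl1] := on_line card_lines lines_meet l; have [l' pl'] := off_point triple card_lines p.
    have ll' : l != l' by apply: contraNneq pl' => <-.
    have [q /andP[ql ql']] := lines_meet ll'.
    have [pf|pf] := pselect (pt p = f l 0); last by exists p.
    exists q => // qf; have [_ _ pt_inj _] := real.
    by move: pl'; rewrite (pt_inj p q) ?ql'// pf qf.
  have [l' ll' ql'] := through_point triple q l; rewrite eq_sym in ll'.
  have [e cr] := common_point ll' ql ql'.
  exact: (lift_odd (cl l) (cl l') e cr qf).
(* [meet (l, l)] is an arbitrary point of [l]. *)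
have /choice[meet meetP] : forall ll : Ln * Ln, exists p, inc p ll.1 && inc p ll.2.
  move=> [l l'] /=; have [<-|ll'] := eqVneq l l'; last exact: lines_meet.
  by have [p pl1] := on_line card_lines lines_meet l; exists p; rewrite pl1.
(* Parameters are taken in [[0, 1[], where the curve is injective; the parameter [1] is replaced by
   [0]. *)
have /choice[pos posP] : forall u : Ln * Pt, exists t : R,
    inc u.2 u.1 -> 0 <= t < 1 /\ f u.1 t = pt u.2.
  move=> [l p] /=; have [pl1|pl1] := boolP (inc p l); last by exists 0.
  have := inc_pl pl1; rewrite (cl_im (cl l)) => -[t /=]; rewrite in_itv/= => /andP[t0 t1] ft.
  have [te|tn] := eqVneq t 1; last by exists t => _; rewrite t0 lt_neqAle tn.
  by exists 0 => _; rewrite lexx ltr01 (cl_loop (cl l)) -te.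
have pos_inj l p q : inc p l -> inc q l -> pos (l, p) = pos (l, q) -> p = q.
  move=> pl1 ql e; have [_ _ pt_inj _] := real; apply: pt_inj.
  by rewrite -(posP (l, p) pl1).2 -(posP (l, q) ql).2 /= e.
have meetl l l' : inc (meet (l, l')) l by have /andP[] := meetP (l, l').
have meetr l l' : inc (meet (l, l')) l' by have /andP[] := meetP (l, l').
have /choice[eps epsP] : forall ll : Ln * Ln, exists e, ll.1 != ll.2 ->
    forall s, 0 <= s < 1 -> s != pos (ll.1, meet ll) ->
    side (g ll.2) (m ll.2) (g ll.1 s) = e (+) (s < pos (ll.1, meet ll)).
  move=> [l l'] /=; have [->|ll'] := eqVneq l l'; first by exists false.
  have [p01 fp] := posP (l, meet (l, l')) (meetl _ _).
  have [|e eP] := line_sides (cl l') (cl l) (m0 l') (m0 l) p01; last by exists e.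
  move=> x x1 x2; have [e _] := common_point ll' (meetl l l') (meetr l l').
  have : (pl l `&` pl l') x by [].
  by rewrite e fp.
pose X p l := side (g l) (m l) (rep (pt p)).
have signP l p : inc p l -> exists k, forall l', ~~ inc p l' ->
    X p l' = k (+) eps (l, l') (+) (pos (l, p) < pos (l, meet (l, l'))).
  move=> pl1; have [t01 fp] := posP (l, p) pl1.
  have t01' : 0 <= pos (l, p) <= 1 by case/andP: t01 => -> /ltW.
  have [c c0] := cl_rep (cl l) t01'; rewrite /= in fp; rewrite fp => ge.
  (* [g l] visits the multiple [c *: rep (pt p)]; as the side is odd, the sign of [c] is the bit
     [k]. *)
  exists (c < 0) => l' pl'; have ll' : l != l' by apply: contraNneq pl' => <-.
  have offp : ~ pl l' (pt p).
    by have [_ _ _ H] := real => /H; apply/negP.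
  have := epsP (l, l') ll' (pos (l, p)) t01.
  rewrite /= ge (cl_sideZ (cl l') c0 offp) m0/= -addbA => <-; last first.
    by apply: contraNneq pl' => /(pos_inj _ _ _ pl1 (meetl _ _)) ->.
  by rewrite /X addbC addbK.
have [l0 _] : exists l0 : Ln, true.
  by have /card_gt0P[l0 _] := ltn_trans (isT : (0 < 3)%N) card_lines; exists l0.
apply: (@no_triple_arrangement _ _ Pt Ln inc (fun l l' => meet (l, l'))
  (fun l p => pos (l, p)) (fun l l' => eps (l, l')) X) => //.
- move=> p l l' ll' p1 p2; exact: (unique_common ll').
- exact: (off_point triple card_lines).
Qed.

End Realization.
End Arrangement.

Theorem proposition1p9 (R : realType) (C : configuration)
  (card_points : #|config_point C| = 26%N)
  (card_lines : #|config_line C| = 13%N)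
  (triple : forall p : config_point C, triple_point p) :
  ~ topologically_realizable R C.
Proof.
move=> [pt [pl real]]; apply: (not_realization real) => //; last by rewrite card_lines.
apply: lines_meet => //; first exact: incident_atmost1.
(* [13 * 13 = 13 + 6 * 26]. *)
by rewrite card_lines card_points.
Qed.
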